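(* Let $Y$ be a separable, infinite-dimensional, complex Banach space, and let $(\alpha_n)_{n\ge0}$ be a sequence of positive real numbers such that $\lim_{n\to\infty}\alpha_n^{1/n}=1$. Then there exists a Banach holomorphic function space $X$ on the open unit disk $\mathbb{D}$ such that: (i) $X$ is isometrically isomorphic to $Y$; (ii) $X$ contains (the restrictions to $\mathbb{D}$ of) all functions holomorphic in a neighborhood of $\overline{\mathbb{D}}$; (iii) polynomials are dense in $X$; (iv) $\|z^n\|_X=\alpha_n$ for all $n\ge0$.
   Context: $\mathbb{D}$ denotes the open unit disk in $\mathbb{C}$, and $\mathrm{Hol}(\mathbb{D})$ the Fréchet space of holomorphic functions on $\mathbb{D}$ with the topology of uniform convergence on compact sets. A Banach holomorphic function space on $\mathbb{D}$ is a (complex) Banach space $X$ that is a subset (linear subspace) of $\mathrm{Hol}(\mathbb{D})$ such that the inclusion map $X\hookrightarrow\mathrm{Hol}(\mathbb{D})$ is continuous. Here $z^n$ denotes the function $z\mapsto z^n$ on $\mathbb{D}$. *)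

(* Defs.v *)
From HB Require Import structures.
From mathcomp Require Import all_boot all_order all_algebra.
From mathcomp Require Import all_classical all_reals all_analysis.
From mathcomp Require Import complex.

Set Implicit Arguments.
Unset Strict Implicit.
Unset Printing Implicit Defensive.

Import Order.TTheory GRing.Theory Num.Theory.
Import numFieldNormedType.Exports.

Local Open Scope classical_set_scope.
Local Open Scope ring_scope.

(* [R[i]^o] is the complex plane as a normed space over itself. Norms of complex
   normed spaces are [R[i]]-valued (nonnegative reals), and scalars [h] in
   [derivable] range over [R[i]], so [derivable f z 1] is complex
   differentiability at [z]. *)

Definition unit_disk (R : realType) : set R[i]^o := [set z | `|z| < 1].

(* Intended for open [U]: only the values of [f] on [U] then matter. *)
Definition holomorphic (R : realType) (U : set R[i]^o) (f : R[i]^o -> R[i]^o) :=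
  forall z, U z -> derivable f z 1.

(* The unit disk as a type, with the subspace topology. *)
Definition disk (R : realType) := set_type (@unit_disk R).

Definition restrict_disk (R : realType) (f : R[i]^o -> R[i]^o) :
    disk R -> R[i]^o :=
  fun z => f (\val z).

Definition Hol (R : realType) : set (disk R -> R[i]^o) :=
  [set f | exists2 g, holomorphic (@unit_disk R) g & f = restrict_disk g].

(* A Banach space that is a linear subspace of [Hol] is given by its inclusion
   map, an injective linear map with values in [Hol]. The topology of [Hol] is
   induced by that of compact convergence on all functions on the disk, so
   continuity into [Hol] is continuity into the latter. *)
Record banach_hol_space (R : realType) := BanachHolSpace {
  bhs_space :> completeNormedModType R[i] ;
  bhs_incl : {linear bhs_space -> (disk R -> R[i]^o)} ;
  bhs_incl_inj : injective bhs_incl ;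
  bhs_incl_hol : forall x, Hol (bhs_incl x) ;
  bhs_incl_continuous :
    continuous (bhs_incl : bhs_space -> {family compact, disk R -> R[i]^o})
}.
Arguments bhs_incl {R} X : rename.

Definition isometrically_isomorphic (K : numFieldType)
    (X Y : normedModType K) :=
  exists phi : {linear X -> Y}, bijective phi /\ forall x, `|phi x| = `|x|.

Definition separable_space (T : topologicalType) :=
  exists2 S : set T, countable S & dense S.

Definition finite_dimensional (K : fieldType) (V : lmodType K) :=
  exists (n : nat) (v : 'I_n -> V),
    forall y : V, exists c : 'I_n -> K, y = \sum_i c i *: v i.

(* Main.v *)
Require Import Defs.
From HB Require Import structures.
From mathcomp Require Import all_boot all_order all_algebra.
From mathcomp Require Import all_classical all_reals all_analysis.
From mathcomp Require Import complex ring lra zify.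

(** The space X is Y itself, with its elements read as power series. Suppose
    that Y carries unit vectors e_n and functionals f_n that are biorthogonal,
    that the span of the e_n is dense, that the f_n separate points, and that
    the norms of the f_n grow subexponentially. Send y to the function
    z |-> sum_n alpha_n^-1 f_n(y) z^n. As alpha_n^(1/n) tends to 1, the series
    converges on the disk, with bounds on smaller disks that are linear in the
    norm of y. It determines every f_n(y), hence y; and alpha_n e_n, which has
    norm alpha_n, becomes z^n. A function holomorphic near the closed disk has
    Taylor coefficients c_n = O(t^n) for some t < 1, so sum_n c_n alpha_n e_n
    converges absolutely in Y, to an element which represents that function.

    Two ingredients carry this plan.

    The basis is given by [markushevich_basis]. A finite biorthogonal system
    defines a projection P of norm at most the sum S of the norms of its
    functionals. It can be extended so that its span reaches a prescribed vector
    ([extend_to_vector]), or so that its functionals control a prescribed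
    functional ([extend_to_functional]), by passing through 1 - P; the new
    functional then has norm of order 1 + S. Repeated at every step this gives
    exponential growth. But in infinite dimension there is also always an
    extension by a functional of norm at most 3 ([extend_boundedly]): following
    Mazur, the new vector is taken in the kernel of finitely many functionals
    which almost norm the finite dimensional span. Performing the expensive
    extensions at dyadic times only, and the cheap one in between, keeps the
    growth polynomial. All functionals come from [hahn_banach].

    The expansion is given by [taylor_expansion], for functions of which only
    complex differentiability is known. Goursat's lemma ([goursat]), read in
    logarithmic coordinates, says that the mean over the circle of radius r does
    not depend on r as long as no singularity is crossed
    ([circle_mean_const]). For w (g(w) - g(z)) / (w - z), which is merely
    continuous at z, the mean cannot jump at r = |z| because it is a continuous
    function of r; it vanishes at r = 0, hence everywhere ([circle_mean_eq0]).
    Expanding w / (w - z) as a geometric series on a circle of radius greater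
    than 1 turns this vanishing into the Taylor expansion of g at 0. *)

Import Order.TTheory GRing.Theory Num.Theory.
Import numFieldNormedType.Exports.

Set Implicit Arguments.
Unset Strict Implicit.
Unset Printing Implicit Defensive.

Local Open Scope classical_set_scope.
Local Open Scope ring_scope.

(** * Real valued norms over the complex numbers *)

Section RealNorm.
Local Open Scope complex_scope.
Variable R : realType.
Local Notation C := R[i].

(** Norms of complex normed spaces take values in the nonnegative part of C,
    which is only partially ordered; [nrm] is the same number in R. *)
Definition nrm (V : normedZmodType C) (x : V) : R := complex.Re `|x|.

Section NormedZmod.
Variable V : normedZmodType C.
Implicit Types x y : V.

Lemma nrmE x : `|x| = (nrm x)%:C.
Proof.
have := normr_ge0 x; rewrite /nrm; case: `|x| => a b.
by rewrite lecE /= => /andP[/eqP -> _].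
Qed.

Lemma nrm_ge0 x : 0 <= nrm x.
Proof. by rewrite -ler0c -nrmE. Qed.

Lemma nrm0 : nrm (0 : V) = 0.
Proof. by rewrite /nrm normr0. Qed.

Lemma nrm_eq0 x : (nrm x == 0) = (x == 0).
Proof. by rewrite -(normr_eq0 x) nrmE; apply/eqP/eqP => [->//|/complexI]. Qed.

Lemma nrm_gt0 x : (0 < nrm x) = (x != 0).
Proof. by rewrite lt_def nrm_ge0 andbT nrm_eq0. Qed.

Lemma nrmD x y : nrm (x + y) <= nrm x + nrm y.
Proof. by rewrite -lecR rmorphD /= -!nrmE ler_normD. Qed.

Lemma nrmN x : nrm (- x) = nrm x.
Proof. by rewrite /nrm normrN. Qed.

Lemma nrmB x y : nrm (x - y) <= nrm x + nrm y.
Proof. by rewrite (le_trans (nrmD _ _))// nrmN. Qed.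

Lemma nrm_distC x y : nrm (x - y) = nrm (y - x).
Proof. by rewrite -nrmN opprB. Qed.

Lemma nrm_triangle z x y : nrm (x - y) <= nrm (x - z) + nrm (z - y).
Proof. by rewrite (le_trans _ (nrmD _ _))// addrA subrK. Qed.

Lemma ler_sub_nrm x y : nrm x - nrm y <= nrm (x - y).
Proof. by rewrite lerBlDr (le_trans _ (nrmD _ _))// subrK. Qed.

Lemma nrm_sum (I : Type) (r : seq I) (P : pred I) (F : I -> V) :
  nrm (\sum_(i <- r | P i) F i) <= \sum_(i <- r | P i) nrm (F i).
Proof.
elim/big_rec2: _ => [|i a b _ h]; first by rewrite nrm0.
by rewrite (le_trans (nrmD _ _))// lerD2l.
Qed.

End NormedZmod.

Lemma nrmZ (V : normedModType C) (a : C) (x : V) : nrm (a *: x) = nrm a * nrm x.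
Proof. by apply: complexI; rewrite -nrmE normrZ !nrmE rmorphM. Qed.

Lemma nrmM (a b : C) : nrm (a * b) = nrm a * nrm b.
Proof. by apply: complexI; rewrite -nrmE normrM !nrmE rmorphM. Qed.

Lemma nrm1 : nrm (1 : C) = 1.
Proof. by apply: complexI; rewrite -nrmE normr1. Qed.

Lemma nrmX (a : C) n : nrm (a ^+ n) = nrm a ^+ n.
Proof. by elim: n => [|n IH]; rewrite ?expr0 ?nrm1// !exprS nrmM IH. Qed.

Lemma nrmV (a : C) : nrm a^-1 = (nrm a)^-1.
Proof.
have [->|a0] := eqVneq a 0; first by rewrite invr0 nrm0 invr0.
apply: (mulfI (x := nrm a)); first by rewrite nrm_eq0.
by rewrite -nrmM !mulfV ?nrm1 ?nrm_eq0.
Qed.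

Lemma nrm_real (a : R) : nrm a%:C = `|a|.
Proof.
by apply: complexI; rewrite -nrmE normc_def /= expr0n addr0 sqrtr_sqr.
Qed.

Lemma nrm_i : nrm ('i : C) = 1.
Proof.
by apply: complexI; rewrite -nrmE normc_def /= expr0n add0r expr1n sqrtr1.
Qed.

Lemma nrm_sqr (a : C) : nrm a ^+ 2 = complex.Re a ^+ 2 + complex.Im a ^+ 2.
Proof. by apply: complexI; rewrite rmorphXn /= -nrmE add_Re2_Im2. Qed.

Lemma Re_le_nrm (a : C) : `|complex.Re a| <= nrm a.
Proof. by rewrite -lecR -nrmE normc_ge_Re. Qed.

Lemma Im_le_nrm (a : C) : `|complex.Im a| <= nrm a.
Proof.
have := Re_le_nrm (a * 'i); rewrite nrmM nrm_i mulr1; case: a => x y /=.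
by rewrite mulr0 mulr1 sub0r normrN.
Qed.

Lemma nrm_le_ReIm (a : C) : nrm a <= `|complex.Re a| + `|complex.Im a|.
Proof.
rewrite {1}[a]complexE (le_trans (nrmD _ _))// nrmM nrm_i mul1r.
by rewrite !nrm_real.
Qed.

End RealNorm.

(** * The Hahn-Banach theorem for complex seminorms *)

Section HahnBanach.
Local Open Scope complex_scope.
Variable R : realType.
Local Notation C := R[i].
Variable V : lmodType C.
Implicit Types (p q : V -> R) (x y : V).

Definition sublinear q :=
  (forall x y, q (x + y) <= q x + q y) /\
  (forall (a : R) x, 0 <= a -> q (a%:C *: x) <= a * q x).

Lemma sublinear0 q : sublinear q -> q 0 = 0.
Proof.
move=> [qD qZ]; apply/eqP; rewrite eq_le; apply/andP; split.
  by have := qZ 0 0 (lexx _); rewrite scaler0 mul0r.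
by have := qD 0 0; rewrite addr0; lra.
Qed.

Lemma sublinear_lb q x : sublinear q -> - q (- x) <= q x.
Proof.
by move=> qs; have := qs.1 x (- x); rewrite subrr (sublinear0 qs); lra.
Qed.

Lemma sublinearZ q (a : R) x : sublinear q -> 0 <= a -> q (a%:C *: x) = a * q x.
Proof.
move=> qs; rewrite le_eqVlt => /predU1P[<-|a0].
  by rewrite scale0r mul0r sublinear0.
apply/eqP; rewrite eq_le; apply/andP; split; first by apply: qs.2; rewrite ltW.
rewrite -ler_pdivlMl//.
have := qs.2 a^-1 (a%:C *: x); rewrite invr_ge0 ltW// => /(_ isT).
by rewrite scalerA -rmorphM mulVf ?gt_eqF// scale1r.
Qed.

Let ray_values q y x :=
  [set q (x + t%:C *: y) - t * q y | t in [set t : R | 0 <= t]].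

(** The largest sublinear functional below q whose value at - y is at most
    - q y. *)
Definition flatten_along q y x := inf (ray_values q y x).

Let ray_values_lb q y x : sublinear q -> lbound (ray_values q y x) (- q (- x)).
Proof.
move=> qs _ [t /= t0 <-].
have := qs.1 (x + t%:C *: y) (- x); rewrite addrAC subrr add0r.
by rewrite sublinearZ//; lra.
Qed.

Let flatten_alongP q y x (t : R) : sublinear q -> 0 <= t ->
  flatten_along q y x <= q (x + t%:C *: y) - t * q y.
Proof.
move=> qs t0; apply: ge_inf; last by exists t.
by exists (- q (- x)); exact: ray_values_lb.
Qed.

Let le_flatten_along q y x b :
  (forall t : R, 0 <= t -> b <= q (x + t%:C *: y) - t * q y) ->
  b <= flatten_along q y x.
Proof.
move=> H; apply: lb_le_inf; first by eexists; exists 0; [exact: lexx|].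
by move=> _ [t /= t0 <-]; exact: H.
Qed.

Lemma flatten_along_le q y x : sublinear q -> flatten_along q y x <= q x.
Proof.
move=> qs; have := flatten_alongP y x qs (lexx 0).
by rewrite scale0r addr0 mul0r subr0.
Qed.

Lemma flatten_alongN q y : sublinear q -> flatten_along q y (- y) <= - q y.
Proof.
move=> qs; have := flatten_alongP y (- y) qs ler01.
by rewrite scale1r addNr sublinear0// mul1r sub0r.
Qed.

Lemma sublinear_flatten_along q y : sublinear q -> sublinear (flatten_along q y).
Proof.
move=> qs; split=> [x x'|a x].
  rewrite -lerBlDr; apply: le_flatten_along => t t0.
  rewrite lerBlDr -lerBlDl; apply: le_flatten_along => s s0.
  rewrite lerBlDl (le_trans (flatten_alongP y _ qs (addr_ge0 t0 s0)))//.
  rewrite rmorphD /= scalerDl addrACA.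
  by have := qs.1 (x + t%:C *: y) (x' + s%:C *: y); lra.
rewrite le_eqVlt => /predU1P[<-|a0].
  by rewrite mul0r scale0r (le_trans (flatten_along_le _ _ qs))// sublinear0.
rewrite mulrC -ler_pdivrMr//; apply: le_flatten_along => t t0.
rewrite ler_pdivrMr//.
have at0 : 0 <= a * t by rewrite mulr_ge0// ltW.
rewrite (le_trans (flatten_alongP y _ qs at0))//.
rewrite rmorphM -scalerA -scalerDr sublinearZ ?(ltW a0)//; lra.
Qed.

(** A sublinear functional which is minimal for the pointwise order coincides
    with all its flattenings, hence is odd, hence is real linear: minimality
    plays the part of maximal extension of partially defined functionals. *)
Lemma sublinear_minimal_below p : sublinear p ->
  exists q, [/\ sublinear q, forall x, q x <= p x &
    forall q', sublinear q' -> (forall x, q' x <= q x) -> q' = q].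
Proof.
move=> ps; pose T := {q | sublinear q /\ forall x, q x <= p x}.
pose le (q1 q2 : T) := `[< forall x, sval q2 x <= sval q1 x >].
have pT : sublinear p /\ forall x, p x <= p x by [].
case: (@Zorn T le) => [q|q1 q2 q3|q1 q2|A Atot|q qmin].
- by apply/asboolP.
- move=> /asboolP h1 /asboolP h2; apply/asboolP => x.
  exact: le_trans (h2 x) (h1 x).
- case: q1 q2 => [q1 P1] [q2 P2] /asboolP/= h1 /asboolP/= h2.
  by apply: eq_exist; apply/funext => x; apply/eqP; rewrite eq_le h1 h2.
- have [->|/set0P[q0 Aq0]] := eqVneq A set0; first by exists (exist _ p pT).
  pose vals x := [set sval q x | q in A].
  have vals_lb x : lbound (vals x) (- p (- x)).
    move=> _ [q Aq <-]; have [qs qp] := svalP q.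
    by rewrite (le_trans _ (sublinear_lb x qs))// lerN2.
  have infP x (q : T) : A q -> inf (vals x) <= sval q x.
    by move=> Aq; apply: ge_inf; [exists (- p (- x)) => //|exists q].
  have le_infP x b : (forall q : T, A q -> b <= sval q x) -> b <= inf (vals x).
    move=> H; apply: lb_le_inf; first by exists (sval q0 x); exists q0.
    by move=> _ [q Aq <-]; exact: H.
  have iT : sublinear (fun x => inf (vals x)) /\ forall x, inf (vals x) <= p x.
    split; [split=> [x y|a x a0]|move=> x].
    + rewrite -lerBlDr; apply: (le_infP) => q1 Aq1.
      rewrite lerBlDr -lerBlDl; apply: (le_infP) => q2 Aq2; rewrite lerBlDl.
      have [q12|q21] := Atot _ _ Aq1 Aq2.
        rewrite (le_trans (infP _ _ Aq2))//.
        rewrite (le_trans ((svalP q2).1.1 _ _))//.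
        by rewrite lerD2r; move/asboolP : q12.
      rewrite (le_trans (infP _ _ Aq1))// (le_trans ((svalP q1).1.1 _ _))//.
      by rewrite lerD2l; move/asboolP : q21.
    + move: a0; rewrite le_eqVlt => /predU1P[<-|a0].
        rewrite mul0r scale0r (le_trans (infP _ _ Aq0))//.
        by rewrite (sublinear0 (svalP q0).1).
      rewrite mulrC -ler_pdivrMr//; apply: (le_infP) => q Aq.
      rewrite ler_pdivrMr// (le_trans (infP _ _ Aq))//.
      by rewrite (sublinearZ _ (svalP q).1 (ltW a0)) mulrC.
    + exact: le_trans (infP _ _ Aq0) ((svalP q0).2 x).
  exists (exist _ (fun x => inf (vals x)) iT : T) => q Aq; apply/asboolP => x /=; exact: infP.
exists (sval q); have [qs qp] := svalP q; split => // q' q's q'q.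
have q'T : sublinear q' /\ forall x, q' x <= p x.
  by split => // x; exact: le_trans (q'q x) (qp x).
have qq' : le q (exist _ q' q'T) by apply/asboolP.
by rewrite -(qmin _ qq').
Qed.

(** Starting Zorn's lemma from the flattening of p along x0 forces the value
    at x0 to be p x0. *)
Lemma real_hahn_banach p x0 : sublinear p ->
  exists u : V -> R, [/\ forall x y, u (x + y) = u x + u y,
    forall (a : R) x, u (a%:C *: x) = a * u x, forall x, u x <= p x
    & u x0 = p x0].
Proof.
move=> ps; have fs := sublinear_flatten_along x0 ps.
have [u [us up umin]] := sublinear_minimal_below fs.
have uN x : u (- x) = - u x.
  apply/eqP; rewrite eq_le; apply/andP; split; last first.
    by have := sublinear_lb (- x) us; rewrite opprK.
  rewrite -[in leLHS](umin _ (sublinear_flatten_along x us)).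
    exact: flatten_alongN.
  by move=> y; exact: flatten_along_le.
have le_up x : u x <= p x by exact: le_trans (up x) (flatten_along_le _ _ ps).
exists u; split => // [x y|a x|].
- apply/eqP; rewrite eq_le us.1/= -lerBrDr.
  by have := us.1 (x + y) (- y); rewrite addrK uN.
- have [a0|a0] := leP 0 a; first exact: sublinearZ.
  have a0' : 0 <= - a by rewrite oppr_ge0 ltW.
  have := sublinearZ x us a0'; rewrite rmorphN scaleNr uN mulNr.
  by move/oppr_inj.
- apply/eqP; rewrite eq_le le_up/=.
  by have := le_trans (up (- x0)) (flatten_alongN x0 ps); rewrite uN lerN2.
Qed.

(** For a complex seminorm, the real functional u is the real part of the
    complex functional u(x) - i u(ix); rotating x so that the value becomes
    real turns the bound on the real part into a bound on the modulus. *)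
Theorem hahn_banach p x0 :
  (forall x y, p (x + y) <= p x + p y) ->
  (forall a x, p (a *: x) = nrm a * p x) ->
  exists f : {scalar V}, f x0 = (p x0)%:C /\ forall x, nrm (f x) <= p x.
Proof.
move=> pD pZ.
have ps : sublinear p.
  by split=> // a x a0; rewrite pZ nrm_real ger0_norm.
have [u [uD uZ up ux0]] := real_hahn_banach x0 ps.
have u0 : u 0 = 0 by have := uZ 0 0; rewrite scaler0 mul0r.
have uN x : u (- x) = - u x.
  by have := uD x (- x); rewrite subrr u0; lra.
pose f x : C := u x +i* (- u ('i *: x)).
have f_lin : scalar f.
  move=> [a b] x y; rewrite /f uD scalerDr uD.
  have -> : (a +i* b) *: x = a%:C *: x + b%:C *: ('i *: x).
    by rewrite scalerA -scalerDl; congr (_ *: _); rewrite {1}[a +i* b]complexE mulrC/= mulrC.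
  rewrite scalerDr !uD !scalerA ![ 'i * _]mulrC -!scalerA !uZ.
  rewrite [ 'i *: ('i *: x)]scalerA -expr2 sqr_i scaleN1r uN.
  by apply/eqP; rewrite eq_complex /=; apply/andP; split; apply/eqP; ring.
pose F : {scalar V} := HB.pack f (GRing.isLinear.Build C V C *%R f f_lin).
have Fbound x : nrm (F x) <= p x.
  have [->|Fx0] := eqVneq (F x) 0.
    have p0 : p 0 = 0 by have := pZ 0 0; rewrite scaler0 nrm0 mul0r.
    rewrite nrm0; have := pD x (- x).
    by rewrite subrr -scaleN1r pZ nrmN nrm1 p0; lra.
  have n0 : nrm (F x) != 0 by rewrite nrm_eq0.
  pose c := (F x)^-1 * (nrm (F x))%:C.
  have c1 : nrm c = 1.
    by rewrite nrmM nrmV nrm_real ger0_norm ?nrm_ge0// mulVf.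
  have Fcx : F (c *: x) = (nrm (F x))%:C.
    by rewrite linearZ /= /c mulrAC mulVf// mul1r.
  have := up (c *: x); rewrite pZ c1 mul1r.
  by have -> : u (c *: x) = nrm (F x) by have := congr1 (@complex.Re R) Fcx.
exists F; split => //.
have Re0 : complex.Re (F x0) = p x0 by rewrite /= ux0.
have := nrm_sqr (F x0); rewrite Re0 => E.
have p0 : 0 <= p x0 by rewrite (le_trans (nrm_ge0 (F x0))).
have : nrm (F x0) ^+ 2 <= p x0 ^+ 2.
  by rewrite lerXn2r ?nnegrE ?nrm_ge0.
rewrite E gerDl => I0.
have : complex.Im (F x0) = 0.
  by apply/eqP; rewrite -sqrf_eq0 eq_le I0 sqr_ge0.
by move=> Im0; apply/eqP; rewrite eq_complex Re0 Im0 /= !eqxx.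
Qed.

End HahnBanach.

(** * Finite nets, common kernels and biorthogonal extensions *)

Section FiniteDimensionalTools.
Local Open Scope complex_scope.
Variable R : realType.
Local Notation C := R[i].

Lemma real_interval_net (B eps : R) : 0 < eps ->
  exists K : seq R, forall x, `|x| <= B -> exists2 k, k \in K & `|x - k| <= eps.
Proof.
move=> e0; exists [seq - B + j%:R * eps | j <- iota 0 (Num.truncn (2 * B / eps)).+1].
move=> x; rewrite ler_norml => /andP[Bx xB].
have q0 : 0 <= (x + B) / eps by rewrite divr_ge0 ?(ltW e0)//; lra.
exists (- B + (Num.truncn ((x + B) / eps))%:R * eps).
  apply/mapP; exists (Num.truncn ((x + B) / eps)) => //.
  rewrite mem_iota /= add0n ltnS le_truncn//.
  by rewrite ler_pM2r ?invr_gt0//; lra.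
have /andP[] := truncn_itv q0.
rewrite ler_pdivlMr// ltr_pdivrMr// -natr1 => h1 h2.
by rewrite ler_norml; apply/andP; split; lra.
Qed.

Lemma complex_disk_net (B eps : R) : 0 < eps ->
  exists K : seq C, forall z, nrm z <= B -> exists2 k, k \in K & nrm (z - k) <= eps.
Proof.
move=> e0; have e20 : 0 < eps / 2 by lra.
have [K netK] := real_interval_net B e20.
exists [seq x +i* y | x <- K, y <- K] => z zB.
have [x xK hx] := netK _ (le_trans (Re_le_nrm z) zB).
have [y yK hy] := netK _ (le_trans (Im_le_nrm z) zB).
exists (x +i* y); first exact: allpairs_f.
rewrite (le_trans (nrm_le_ReIm _))//.
by case: z hx hy {zB} => a b /= hx hy; lra.
Qed.

(** Total boundedness of bounded sets in a finite dimensional span, in terms of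
    coordinates: the biorthogonal functionals bound these for vectors of a
    bounded set. *)
Lemma bounded_combinations_net (V : normedModType C) (e : nat -> V) (B eps : R) n :
  0 < eps -> (forall i, (i < n)%N -> nrm (e i) = 1) ->
  exists L : seq V, forall c : nat -> C, (forall i, (i < n)%N -> nrm (c i) <= B) ->
    exists2 y, y \in L & nrm (\sum_(i < n) c i *: e i - y) <= n%:R * eps.
Proof.
move=> e0; have [K netK] := complex_disk_net B e0.
elim: n => [|n IH] e1.
  exists [:: 0] => c _; exists 0; rewrite ?inE// big_ord0 subr0 nrm0.
  by rewrite mul0r.
have [|L netL] := IH; first by move=> i ni; rewrite e1// ltnS ltnW.
exists [seq y + k *: e n | y <- L, k <- K] => c cB.
have [|y yL hy] := netL c; first by move=> i ni; apply: cB; rewrite ltnS ltnW.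
have [k kK hk] := netK _ (cB n (ltnSn n)).
exists (y + k *: e n); first exact: allpairs_f.
rewrite big_ord_recr /= opprD addrACA -scalerBl (le_trans (nrmD _ _))//.
by rewrite nrmZ e1// mulr1 -natr1 mulrDl mul1r lerD.
Qed.

(** Modulo the common kernel of n functionals the space is spanned by at most n
    vectors, each added to repair one functional. *)
Lemma common_kernel (V : lmodType C) (h : nat -> {scalar V}) n :
  ~ finite_dimensional V -> exists2 w, w != 0 & forall i, (i < n)%N -> h i w = 0.
Proof.
move=> Vinf.
have [m [v vP]] : exists m (v : nat -> V), forall y, exists c : nat -> C,
    forall i, (i < n)%N -> h i (y - \sum_(j < m) c j *: v j) = 0.
  elim: n => [|n [m [v vP]]].
    by exists 0%N, (fun=> 0) => y; exists (fun=> 0).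
  have [[w [wker hw]]|nw] :=
      pselect (exists w, (forall i, (i < n)%N -> h i w = 0) /\ h n w != 0).
    exists m.+1, (fun j => if j == m then w else v j) => y.
    have [c cP] := vP y.
    set r := y - _ in cP.
    exists (fun j => if j == m then h n r / h n w else c j) => i.
    rewrite big_ord_recr /= eqxx opprD addrA.
    under eq_bigr do rewrite (ltn_eqF (ltn_ord _)).
    rewrite -/r linearB linearZ ltnS leq_eqVlt => /predU1P[->|ni].
      by rewrite /= divfK// subrr.
    by rewrite /= (cP i ni) (wker i ni) mulr0 subrr.
  exists m, v => y; have [c cP] := vP y; exists c => i.
  rewrite ltnS leq_eqVlt => /predU1P[->|ni]; last exact: cP.
  by apply/eqP; apply: contra_notT nw => hn; exists (y - \sum_(j < m) c j *: v j).
apply: contrapT => nex; apply: Vinf; exists m, (fun j => v j) => y.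
have [c cP] := vP y; exists (fun j => c j); apply/eqP; rewrite -subr_eq0.
by apply: contra_notT nex => r0; exists (y - \sum_(j < m) c j *: v j).
Qed.

End FiniteDimensionalTools.

Section BiorthogonalExtension.
Local Open Scope complex_scope.
Variable R : realType.
Local Notation C := R[i].
Variable V : normedModType C.
Variables (N : nat) (e : nat -> V) (f : nat -> {scalar V}) (b : nat -> R).
Hypothesis e1 : forall i, (i < N)%N -> nrm (e i) = 1.
Hypothesis fe : forall i j, (i < N)%N -> (j < N)%N -> f i (e j) = (i == j)%:R.
Hypothesis fb : forall i y, (i < N)%N -> nrm (f i y) <= b i * nrm y.

Definition biproj y := \sum_(i < N) f i y *: e i.

Lemma biproj_linear : linear biproj.
Proof.
move=> a x y; rewrite /biproj scaler_sumr -big_split; apply: eq_bigr => i _ /=.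
by rewrite linearP scalerDl scalerA.
Qed.

HB.instance Definition _ := GRing.isLinear.Build C V V *:%R biproj biproj_linear.

Lemma biproj_vec i : (i < N)%N -> biproj (e i) = e i.
Proof.
move=> iN; rewrite /biproj (bigD1 (Ordinal iN))//= fe// eqxx scale1r.
rewrite big1 ?addr0// => j /negPf ji.
by rewrite fe// (_ : (j == i :> nat) = false) ?scale0r// -ji.
Qed.

Lemma coord_biproj i y : (i < N)%N -> f i (biproj y) = f i y.
Proof.
move=> iN; rewrite /biproj linear_sum (bigD1 (Ordinal iN))//= linearZ /= fe//.
rewrite eqxx mulr1 big1 ?addr0// => j /negPf ji.
by rewrite linearZ /= fe// eq_sym (_ : (j == i :> nat) = false) ?mulr0// -ji.
Qed.

Lemma biprojK y : biproj (biproj y) = biproj y.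
Proof. by rewrite {1}/biproj; apply: eq_bigr => i _; rewrite coord_biproj. Qed.

Lemma biproj_eq0 y : (forall i, (i < N)%N -> f i y = 0) -> biproj y = 0.
Proof. by move=> fy; rewrite /biproj big1// => i _; rewrite fy// scale0r. Qed.

Lemma coord_bound_ge0 i : (i < N)%N -> 0 <= b i.
Proof.
by move=> iN; have := fb (e i) iN; rewrite e1// fe// eqxx nrm1; lra.
Qed.

Local Notation S := (1 + \sum_(i < N) b i).

Lemma coord_sum_ge1 : 1 <= S.
Proof.
by rewrite lerDl sumr_ge0// => i _; exact: coord_bound_ge0.
Qed.

Lemma nrm_biproj_compl y : nrm (y - biproj y) <= S * nrm y.
Proof.
rewrite (le_trans (nrmB _ _))// mulrDl mul1r lerD2l mulr_suml.
rewrite (le_trans (nrm_sum _ _ _))//; apply: ler_sum => i _.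
by rewrite nrmZ e1// mulr1 fb.
Qed.

Definition extends_biorthogonally (e' : V) (f' : {scalar V}) (b' : R) :=
  [/\ nrm e' = 1, f' e' = 1,
      forall i, (i < N)%N -> f i e' = 0 /\ f' (e i) = 0
    & forall y, nrm (f' y) <= b' * nrm y].

Lemma scalar_comp_biproj_compl (g : {scalar V}) :
  exists q : {scalar V}, forall y, q y = g (y - biproj y).
Proof.
have q_lin : scalar (fun y => g (y - biproj y)).
  move=> a x y; rewrite -linearP; congr (g _).
  by rewrite linearP opprD addrACA scalerBr.
pose q : {scalar V} := HB.pack (fun y => g (y - biproj y))
  (GRing.isLinear.Build C V C *%R _ q_lin).
by exists q.
Qed.

Lemma scalar_scale (a : C) (g : {scalar V}) :
  exists q : {scalar V}, forall y, q y = a * g y.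
Proof.
have q_lin : scalar (fun y => a * g y).
  by move=> k x y; rewrite linearP /= mulrDr mulrCA.
pose q : {scalar V} := HB.pack (fun y => a * g y)
  (GRing.isLinear.Build C V C *%R _ q_lin).
by exists q.
Qed.

Lemma norming_functional (x : V) :
  exists g : {scalar V}, g x = (nrm x)%:C /\ forall y, nrm (g y) <= nrm y.
Proof. by apply: (@hahn_banach R V (@nrm R V)) => *; [exact: nrmD|exact: nrmZ]. Qed.

Lemma normalized (x : V) : x != 0 -> nrm ((nrm x)^-1%:C *: x) = 1.
Proof.
move=> x0; rewrite nrmZ nrm_real ger0_norm ?invr_ge0 ?nrm_ge0//.
by rewrite mulVf ?nrm_eq0.
Qed.

(** The new vector is the normalized part of x outside of the span, and the new
    functional norms it after the component in the span has been removed. *)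
Lemma extend_to_vector (x : V) : biproj x != x ->
  exists e' f', extends_biorthogonally e' f' S /\ x = biproj x + f' x *: e'.
Proof.
rewrite eq_sym -subr_eq0; set r := x - _ => r0.
pose e' := (nrm r)^-1%:C *: r.
have [g [ge' gb]] := norming_functional e'.
have [q qE] := scalar_comp_biproj_compl g.
have Pr : biproj r = 0 by rewrite linearB /= biprojK subrr.
have Pe' : biproj e' = 0 by rewrite linearZ /= Pr scaler0.
have e'1 : nrm e' = 1 by exact: normalized.
exists e', q; split; [split => //|].
- by rewrite qE Pe' subr0 ge' e'1.
- move=> i iN; split; first by rewrite -coord_biproj// Pe' linear0.
  by rewrite qE biproj_vec// subrr linear0.
- by move=> y; rewrite qE (le_trans (gb _))// nrm_biproj_compl.
- have -> : q x = (nrm r)%:C.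
    rewrite qE -/r -[r in g r](scale1r) -(mulfV (_ : (nrm r)%:C != 0)).
      by rewrite -scalerA linearZ /= -fmorphV ge' e'1 mulr1.
    by rewrite (inj_eq (@complexI R) _ 0) nrm_eq0.
  rewrite /e' scalerA -rmorphM mulfV ?nrm_eq0// scale1r.
  by rewrite /r addrC subrK.
Qed.

(** The new functional is the part q of g which vanishes on the span; the new
    vector comes from a point where q attains half of its norm. Modulo the
    coordinate functionals, g is a multiple of the new functional. *)
Lemma extend_to_functional (g : {scalar V}) :
  (forall y, nrm (g y) <= nrm y) -> (exists y, g (y - biproj y) != 0) ->
  exists e' f', extends_biorthogonally e' f' (2 * S) /\
    forall y, biproj y = 0 -> f' y = 0 -> g y = 0.
Proof.
move=> gb [y0]; have [q qE] := scalar_comp_biproj_compl g.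
rewrite -qE => qy0.
have S1 := coord_sum_ge1; have S0 : 0 < S by exact: lt_le_trans S1.
have qb y : nrm (q y) <= S * nrm y.
  by rewrite qE (le_trans (gb _))// nrm_biproj_compl.
pose A := [set nrm (q y) | y in [set y | nrm y <= 1]].
have Aub : ubound A S.
  move=> _ [y /= y1 <-]; rewrite (le_trans (qb y))//.
  by rewrite -[leRHS]mulr1 ler_pM2l.
have A0 : A !=set0 by exists (nrm (q 0)); exists 0; rewrite //= nrm0.
have supA : has_sup A by split => //; exists S.
have le_sup z : nrm (q z) <= sup A * nrm z.
  have [->|z0] := eqVneq z 0; first by rewrite linear0 !nrm0 mulr0.
  rewrite -ler_pdivrMr ?nrm_gt0//; apply: ub_le_sup; first by exists S.
  exists ((nrm z)^-1%:C *: z) => /=; first by rewrite normalized.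
  rewrite linearZ /= nrmM nrm_real mulrC ger0_norm// invr_ge0 nrm_ge0//.
have sup0 : 0 < sup A.
  rewrite ltNge; apply/negP => le0; move: qy0; rewrite -nrm_gt0 ltNge.
  by rewrite (le_trans (le_sup _))// mulr_le0_ge0// nrm_ge0.
have sup20 : 0 < sup A / 2 by lra.
have [_ [y /= y1 <-] hy] := sup_adherent sup20 supA.
have qy_gt : sup A < 2 * nrm (q y) by lra.
have qy0' : 0 < nrm (q y) by lra.
have qy_neq0 : q y != 0 by rewrite -nrm_gt0.
pose r := y - biproj y.
have Pr : biproj r = 0 by rewrite linearB /= biprojK subrr.
have qr : q r = q y by rewrite !qE Pr subr0.
have r0 : r != 0 by apply: contraNneq qy_neq0 => r0; rewrite -qr r0 linear0.
pose e' := (nrm r)^-1%:C *: r.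
have [f' f'E] := scalar_scale ((nrm r)%:C / q y) q.
have Pe' : biproj e' = 0 by rewrite linearZ /= Pr scaler0.
exists e', f'; split; [split|].
- exact: normalized.
- have rC0 : (nrm r)%:C != 0 :> C by rewrite (inj_eq (@complexI R) _ 0) nrm_eq0.
  by rewrite f'E linearZ /= qr fmorphV /=; field; rewrite rC0 qy_neq0.
- move=> i iN; split; first by rewrite -coord_biproj// Pe' linear0.
  by rewrite f'E (qE (e i)) biproj_vec// subrr linear0 mulr0.
- move=> z; rewrite f'E !nrmM nrmV nrm_real ger0_norm ?nrm_ge0//.
  rewrite mulrAC ler_pdivrMr//.
  have rS : nrm r <= S.
    by rewrite (le_trans (nrm_biproj_compl y))// -[leRHS]mulr1 ler_pM2l.
  rewrite (le_trans (ler_pM (nrm_ge0 _) (nrm_ge0 _) rS (le_sup z)))//.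
  have Sz0 : 0 <= S * nrm z by rewrite mulr_ge0 ?nrm_ge0// ltW.
  have := ler_wpM2l Sz0 (ltW qy_gt); set s := \sum_(i < N) b i.
  by move=> h; nra.
- move=> z Pz; rewrite f'E (qE z) Pz subr0 => /eqP; rewrite !mulf_eq0 invr_eq0.
  rewrite (negPf qy_neq0) orbF => /orP[|/eqP//].
  by rewrite (inj_eq (@complexI R) _ 0) nrm_eq0 (negPf r0).
Qed.

End BiorthogonalExtension.

(** * Bounded extensions by Mazur's method *)

Section GoodExtension.
Local Open Scope complex_scope.
Variable R : realType.
Local Notation C := R[i].
Variable V : normedModType C.
Variables (N : nat) (e : nat -> V) (f : nat -> {scalar V}) (b : nat -> R).
Hypothesis e1 : forall i, (i < N)%N -> nrm (e i) = 1.
Hypothesis fe : forall i j, (i < N)%N -> (j < N)%N -> f i (e j) = (i == j)%:R.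
Hypothesis fb : forall i y, (i < N)%N -> nrm (f i y) <= b i * nrm y.

Local Notation P := (biproj N e f).

(* The distance to the span, which is the range of P. *)
Let span_dist (y : V) := inf [set nrm (y - P z) | z in setT].

Let span_dist_le y z : span_dist y <= nrm (y - P z).
Proof.
apply: ge_inf; last by exists z.
by exists 0 => _ [t _ <-]; exact: nrm_ge0.
Qed.

Let le_span_dist y d : (forall z, d <= nrm (y - P z)) -> d <= span_dist y.
Proof.
move=> H; apply: lb_le_inf; first by exists (nrm (y - P 0)); exists 0.
by move=> _ [t _ <-]; exact: H.
Qed.

Let span_distD x y : span_dist (x + y) <= span_dist x + span_dist y.
Proof.
rewrite -lerBlDr; apply: le_span_dist => z.
rewrite lerBlDr -lerBlDl; apply: le_span_dist => t.
rewrite lerBlDl (le_trans (span_dist_le _ (z + t)))//.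
by rewrite linearD opprD addrACA nrmD.
Qed.

Let span_distZ a y : span_dist (a *: y) = nrm a * span_dist y.
Proof.
have le a' y' : span_dist (a' *: y') <= nrm a' * span_dist y'.
  have [->|a0] := eqVneq a' 0.
    rewrite scale0r nrm0 mul0r (le_trans (span_dist_le _ 0))//.
    by rewrite linear0 subr0 nrm0.
  rewrite -ler_pdivrMl ?nrm_gt0//; apply: le_span_dist => z.
  rewrite ler_pdivrMl ?nrm_gt0// (le_trans (span_dist_le _ (a' *: z)))//.
  by rewrite linearZ -scalerBr nrmZ.
have [->|a0] := eqVneq a 0.
  apply/eqP; rewrite eq_le le/= nrm0 mul0r.
  by apply: le_span_dist => z; exact: nrm_ge0.
apply/eqP; rewrite eq_le le/= -ler_pdivlMl ?nrm_gt0// -nrmV.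
by rewrite -[in leLHS](scalerK a0 y) le.
Qed.

(** Finitely many functionals h_y norm the unit sphere of the span up to a
    factor 1/2. A unit vector e' killed by all of them satisfies
    |v| <= 2 |e' - v| on the span, hence 1 = |e'| <= 3 |e' - v|. *)
Lemma separated_vector : ~ finite_dimensional V ->
  exists e', [/\ nrm e' = 1, forall i, (i < N)%N -> f i e' = 0
    & forall z, 1 <= 3 * nrm (e' - P z)].
Proof.
move=> Vinf; pose eps : R := (4 * N.+1%:R)^-1.
have eps0 : 0 < eps by rewrite invr_gt0 mulr_gt0.
have Neps : N%:R * eps <= 4^-1.
  rewrite /eps invfM mulrCA ler_piMr ?invr_ge0// ler_pdivrMr// mul1r ler_nat.
  exact: leqnSn.
pose B := \sum_(i < N) b i.
have bB i : (i < N)%N -> b i <= B.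
  move=> iN; rewrite /B (bigD1 (Ordinal iN))//= lerDl sumr_ge0// => j _.
  exact: (coord_bound_ge0 e1 fe fb).
(* The mesh is chosen so that the net is 1/4-dense for all N coordinates. *)
have [L netL] := bounded_combinations_net B eps0 e1.
have [h hP] := choice (@norming_functional R V).
have [w w0 kw] := common_kernel
  (fun i => if (i < N)%N then f i else h (nth 0 L (i - N))) (N + size L) Vinf.
pose e' := (nrm w)^-1%:C *: w.
have fe' i : (i < N)%N -> f i e' = 0.
  move=> iN; rewrite linearZ /=.
  by have := kw i; rewrite iN => ->; rewrite ?mulr0// ltn_addr.
have he' y : y \in L -> h y e' = 0.
  move=> yL; rewrite linearZ /=; have := kw (N + index y L)%N.
  rewrite ltn_add2l index_mem yL ltnNge leq_addr /= addKn nth_index//.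
  by move=> ->; rewrite ?mulr0.
have e'1 : nrm e' = 1 by exact: normalized.
have unit_case z t : nrm (P z) = 1 -> 1 <= 2 * nrm (t *: e' - P z).
  move=> Pz1; have [|y yL hy] := netL (fun i => f i (P z)).
    move=> i iN; rewrite (le_trans (fb _ iN))// Pz1 mulr1; exact: bB.
  have Pz2 : \sum_(i < N) f i (P z) *: e i = P z by exact: biprojK.
  rewrite Pz2 in hy.
  have hy4 := le_trans hy Neps.
  have [hy1 hy2] := hP y.
  have := hy2 (t *: e' - P z); rewrite linearB linearZ /= he'// mulr0 sub0r nrmN.
  have := ler_sub_nrm (h y y) (h y (y - P z)).
  rewrite [h y y - _](_ : _ = h y (P z)); last by rewrite linearB subKr.
  rewrite hy1 nrm_real ger0_norm ?nrm_ge0//.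
  have := hy2 (y - P z); have := nrm_triangle y (P z) 0.
  rewrite !subr0 Pz1 [nrm (y - P z)]nrm_distC.
  by move=> ? ? ? ?; lra.
exists e'; split => // z.
have [Pz0|Pz0] := eqVneq (P z) 0; first by rewrite Pz0 subr0 e'1; lra.
have n0 : 0 < nrm (P z) by rewrite nrm_gt0.
have := unit_case ((nrm (P z))^-1%:C *: z) (nrm (P z))^-1%:C.
rewrite linearZ /= normalized// => /(_ erefl).
rewrite -scalerBr nrmZ nrm_real ger0_norm ?invr_ge0 ?nrm_ge0// mulrCA.
rewrite mulrC ler_pdivlMr// mul1r => h1.
have := ler_sub_nrm e' (e' - P z); rewrite subKr e'1; lra.
Qed.

(** The distance to the span is a seminorm, so a functional dominated by it
    kills the span; at e' it can be made as large as that distance. *)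
Lemma extend_boundedly : ~ finite_dimensional V ->
  exists e' f', extends_biorthogonally N e f e' f' 3.
Proof.
move=> Vinf; have [e' [e'1 fe' sep]] := separated_vector Vinf.
have [g [ge' gb]] := hahn_banach e' span_distD span_distZ.
have d0 : 1 / 3 <= span_dist e'.
  by apply: le_span_dist => z; have := sep z; lra.
have d0' : 0 < span_dist e' by lra.
have [f' f'E] := scalar_scale ((span_dist e')^-1)%:C g.
have span_dist_nrm y : span_dist y <= nrm y.
  by rewrite (le_trans (span_dist_le _ 0))// linear0 subr0.
exists e', f'; split => //.
- by rewrite f'E ge' -rmorphM mulVf ?gt_eqF.
- move=> i iN; split; first exact: fe'.
  apply/eqP; rewrite -nrm_eq0 eq_le nrm_ge0 andbT f'E nrmM.
  rewrite (_ : nrm (g _) = 0) ?mulr0//.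
  apply/eqP; rewrite eq_le nrm_ge0 andbT (le_trans (gb _))//.
  by rewrite (le_trans (span_dist_le _ (e i)))// biproj_vec// subrr nrm0.
- move=> y; rewrite f'E nrmM nrm_real ger0_norm ?invr_ge0 ?(ltW d0')//.
  rewrite ler_pdivrMl// (le_trans (gb _))// (le_trans (span_dist_nrm y))//.
  by rewrite mulrA ler_peMl ?nrm_ge0//; lra.
Qed.

End GoodExtension.

(** * A biorthogonal basis of polynomial growth *)

Section HistoryRecursion.
Local Open Scope complex_scope.
Variables (T : Type) (d : T) (Step : nat -> (nat -> T) -> T -> Prop).
Hypothesis Step_prefix : forall n u v x, (forall i, (i < n)%N -> u i = v i) ->
  Step n u x -> Step n v x.
Hypothesis Step_ex : forall n u, (forall m, (m < n)%N -> Step m u (u m)) ->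
  exists x, Step n u x.

(** Dependent choice, where every step may depend on all the previous ones. *)
Lemma history_recursion : exists u, forall n, Step n u (u n).
Proof.
have [F FP] : exists F : nat -> (nat -> T) -> T, forall n u,
    (exists x, Step n u x) -> Step n u (F n u).
  have /choice[F FP] : forall nu : nat * (nat -> T), exists x,
      (exists y, Step nu.1 nu.2 y) -> Step nu.1 nu.2 x.
    move=> [n u]; have [[x Sx]|nx] := pselect (exists x, Step n u x).
      by exists x.
    by exists d.
  by exists (fun n u => F (n, u)) => n u; exact: (FP (n, u)).
pose L := fix L n := if n is m.+1 then rcons (L m) (F m (nth d (L m))) else [::].
have sL n : size (L n) = n by elim: n => //= n IH; rewrite size_rcons IH.
pose u n := nth d (L n.+1) n.
have uE n : u n = F n (nth d (L n)) by rewrite /u /= nth_rcons sL ltnn eqxx.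
have Lu n i : (i < n)%N -> nth d (L n) i = u i.
  elim: n => // n IH; rewrite ltnS leq_eqVlt => /predU1P[->//|iltn].
  by rewrite /= nth_rcons sL iltn IH.
exists u => n; elim/ltn_ind: n => n IH; rewrite uE.
apply: (Step_prefix (Lu n)); apply: FP; apply: Step_ex => m mn.
rewrite Lu//; apply: Step_prefix (IH m mn) => i im.
by rewrite Lu// (ltn_trans im).
Qed.

End HistoryRecursion.

Section MarkushevichBasis.
Local Open Scope complex_scope.
Variable R : realType.
Local Notation C := R[i].
Variable V : normedModType C.
Hypothesis Vinf : ~ finite_dimensional V.
Variables (xs : nat -> V) (gs : nat -> {scalar V}).
Hypothesis gs_bound : forall k y, nrm (gs k y) <= nrm y.

(* Slot n is used for a prescribed extension when n + 2 is a power of 2; level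
   n, which grows at these slots only, is then the number of the task. *)
Let level n := trunc_log 2 n.+1.

Let scheduled n := level n != level n.+1.

Let slot_of_task k : exists n, level n = k /\ scheduled n.
Proof.
have k2 : (2 <= 2 ^ k.+1)%N by rewrite -{1}(expn1 2) leq_exp2l.
exists (2 ^ k.+1 - 2)%N; rewrite /scheduled /level.
have -> : (2 ^ k.+1 - 2).+2 = (2 ^ k.+1)%N by rewrite -addn2 subnK.
have -> : trunc_log 2 (2 ^ k.+1 - 2).+1 = k.
  apply: trunc_log_eq => //; rewrite expnS in k2 *; apply/andP; split; last by lia.
  have : (1 <= 2 ^ k)%N by rewrite expn_gt0.
  lia.
by rewrite trunc_expnK// ltn_eqF.
Qed.

Let slot_achieves k N (e : nat -> V) (f : nat -> {scalar V}) (e' : V)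
    (f' : {scalar V}) : Prop :=
  if odd k then forall y, biproj N e f y = 0 -> f' y = 0 -> gs k./2 y = 0
  else xs k./2 = biproj N e f (xs k./2) + f' (xs k./2) *: e'.

Let slot := (V * {scalar V} * R)%type.
Let vec (u : nat -> slot) i := (u i).1.1.
Let fun_ (u : nat -> slot) i := (u i).1.2.
Let bnd (u : nat -> slot) i := (u i).2.
Let total n (u : nat -> slot) := 1 + \sum_(i < n) bnd u i.

Let Step n (u : nat -> slot) (x : slot) :=
  [/\ extends_biorthogonally n (vec u) (fun_ u) x.1.1 x.1.2 x.2,
      x.2 <= (if scheduled n then 3 * total n u else 3) &
      scheduled n -> slot_achieves (level n) n (vec u) (fun_ u) x.1.1 x.1.2].

Let Step_prefix n u v x : (forall i, (i < n)%N -> u i = v i) ->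
  Step n u x -> Step n v x.
Proof.
move=> uv; have totE : total n u = total n v.
  by congr (_ + _); apply: eq_bigr => i _; rewrite /bnd uv.
have projE y : biproj n (vec u) (fun_ u) y = biproj n (vec v) (fun_ v) y.
  by apply: eq_bigr => i _; rewrite /vec /fun_ uv.
rewrite /Step totE => -[[h1 h2 h3 h4] xb ach]; split => //.
  by split => // i iN; rewrite /vec /fun_ -uv//; exact: h3.
move=> /ach; rewrite /slot_achieves; case: ifP => _; last by rewrite projE.
by move=> h y; rewrite -projE; exact: h.
Qed.

Section Prefix.
Variables (n : nat) (u : nat -> slot).
Hypothesis prefix : forall m, (m < n)%N -> Step m u (u m).

Let prefix_norm i : (i < n)%N -> nrm (vec u i) = 1.
Proof. by move=> /prefix[[]]. Qed.

Let prefix_biorth i j : (i < n)%N -> (j < n)%N ->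
  fun_ u i (vec u j) = (i == j)%:R.
Proof.
move=> iN jN; have [ij|ji|<-] := ltngtP i j.
- by have [[_ _ h _] _ _] := prefix jN; exact: (h i ij).1.
- by have [[_ _ h _] _ _] := prefix iN; exact: (h j ji).2.
- by have [[_ h _ _] _ _] := prefix iN.
Qed.

Let prefix_bound i y : (i < n)%N -> nrm (fun_ u i y) <= bnd u i * nrm y.
Proof. by move=> /prefix[[_ _ _ h] _ _]; exact: h. Qed.

Lemma slot_exists : exists x, Step n u x.
Proof.
have tot1 : 1 <= total n u := coord_sum_ge1 prefix_norm prefix_biorth prefix_bound.
have [e0 [f0 ext0]] := extend_boundedly prefix_norm prefix_biorth prefix_bound Vinf.
have [sch|nsch] := boolP (scheduled n); last first.
  by exists (e0, f0, 3); split => //=; rewrite (negPf nsch).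
rewrite /Step sch /slot_achieves; set k := level n.
have [kodd|keven] := boolP (odd k).
  pose g := gs k./2.
  have [[y gy]|ng] := pselect (exists y, g (y - biproj n (vec u) (fun_ u) y) != 0).
    have [e' [f' [ext ach]]] := extend_to_functional
      prefix_norm prefix_biorth prefix_bound (gs_bound k./2) (ex_intro _ y gy).
    exists (e', f', 2 * total n u); split => //=; lra.
  exists (e0, f0, 3); split => //=; first lra.
  move=> _ y Py _; apply/eqP; apply: contra_notT ng => gy.
  by exists y; rewrite Py subr0.
have [Px|Px] := eqVneq (biproj n (vec u) (fun_ u) (xs k./2)) (xs k./2); last first.
  have [e' [f' [ext ach]]] := extend_to_vector
    prefix_norm prefix_biorth prefix_bound Px.
  exists (e', f', total n u); split => //=; lra.
exists (e0, f0, 3); split => //=; first lra.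
move=> _; rewrite Px -{3}Px /biproj linear_sum big1 ?scale0r ?addr0// => i _.
have [_ _ h _] := ext0.
by rewrite linearZ /= (h i (ltn_ord i)).2 mulr0.
Qed.

End Prefix.

(* A scheduled slot multiplies the total by at most 4, which the factor
   4 ^ level absorbs; any other slot adds at most 3. *)
Let total_growth u n : (forall m, Step m u (u m)) ->
  1 <= total n u <= 4 * n.+1%:R * 4 ^+ level n.
Proof.
move=> uP; elim: n => [|n /andP[IH1 IH2]].
  rewrite /total big_ord0 /level trunc_log1 expr0 addr0 mulr1 mulr1n.
  by apply/andP; split; lra.
have := uP n; rewrite /Step => -[[en1 fen _ fb] bn _].
have b0 : 0 <= bnd u n.
  by have := fb (vec u n); rewrite en1 fen nrm1 mulr1 /bnd; lra.
have -> : total n.+1 u = total n u + bnd u n.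
  by rewrite /total big_ord_recr /= addrA.
apply/andP; split; first by lra.
set q : R := 4 ^+ level n in IH2.
have q1 : 1 <= q by rewrite /q exprn_ege1//; lra.
have nq : 0 <= n%:R * q by rewrite mulr_ge0// (le_trans ler01).
rewrite -[n.+2%:R]natr1 -[n.+1%:R]natr1 in IH2 *.
move: bn; rewrite /scheduled; case: eqVneq => [<-|sch] /=.
  by rewrite -/q /bnd; lra.
have : (level n < level n.+1)%N.
  by rewrite ltn_neqAle sch /level leq_trunc_log.
move=> lvl bn.
have : 4 * q <= 4 ^+ level n.+1.
  by rewrite /q -exprS ler_weXn2l//; lra.
set q' : R := 4 ^+ _ => qq'.
have : (n%:R + 1 + 1) * (4 * q) <= (n%:R + 1 + 1) * q'.
  by rewrite ler_pM2l// ltr_wpDl// addr_ge0.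
by rewrite /bnd; nra.
Qed.

(** Every task k is performed, in the slot n = 2 ^ (k + 1) - 2. The norms grow
    like n * 4 ^ log2 n, hence no faster than n ^ 3. *)
Theorem markushevich_basis : exists (e : nat -> V) (f : nat -> {scalar V}),
  [/\ forall n, nrm (e n) = 1,
      forall i j, f i (e j) = (i == j)%:R,
      forall n y, nrm (f n y) <= 4 * n.+2%:R ^+ 3 * nrm y,
      forall k, exists N, xs k = biproj N e f (xs k) &
      forall k y, (forall n, f n y = 0) -> gs k y = 0].
Proof.
have [u uP] := history_recursion ((0, gs 0, 0) : slot) Step_prefix slot_exists.
have e1 n : nrm (vec u n) = 1 by have [[]] := uP n.
exists (vec u), (fun_ u); split => //.
- move=> i j; have [ij|ji|<-] := ltngtP i j.
  + by have [[_ _ h _] _ _] := uP j; exact: (h i ij).1.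
  + by have [[_ _ h _] _ _] := uP i; exact: (h j ji).2.
  + by have [[_ h _ _] _ _] := uP i.
- move=> n y; have [[_ _ _ /(_ y) h] _ _] := uP n.
  rewrite (le_trans h)// ler_wpM2r ?nrm_ge0//.
  have /andP[_] := total_growth n.+1 uP.
  have /andP[t1 _] := total_growth n uP.
  rewrite (_ : total n.+1 u = total n u + bnd u n); last first.
    by rewrite /total big_ord_recr /= addrA.
  have : 4 ^+ level n.+1 <= n.+2%:R ^+ 2 :> R.
    rewrite (_ : 4 = 2%:R ^+ 2 :> R); last by rewrite -natrX.
    rewrite exprAC lerXn2r ?nnegrE ?exprn_ge0// -natrX ler_nat.
    exact: trunc_logP.
  move=> h1 h2; rewrite -/(bnd u n) exprS mulrA.
  have : 4 * n.+2%:R * 4 ^+ level n.+1 <= 4 * n.+2%:R * n.+2%:R ^+ 2 :> R.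
    by rewrite ler_wpM2l.
  lra.
- move=> k; have [n [lvln sch]] := slot_of_task k.*2.
  exists n.+1; have [_ _ /(_ sch)] := uP n.
  rewrite lvln /slot_achieves odd_double doubleK {1 2}/biproj => E.
  by rewrite [LHS]E /biproj big_ord_recr.
- move=> k y fy; have [n [lvln sch]] := slot_of_task k.*2.+1.
  have [_ _ /(_ sch)] := uP n.
  rewrite lvln /slot_achieves /= odd_double /= uphalf_double; apply.
    by rewrite biproj_eq0.
  exact: fy.
Qed.

End MarkushevichBasis.

(** * Subexponential sequences and power series *)

Section Subexponential.
Local Open Scope complex_scope.
Variable R : realType.
Implicit Types (u v : nat -> R).

Definition subexponential u :=
  forall q, 1 < q -> exists K, forall n, u n <= K * q ^+ n.

(** A bound that holds eventually holds everywhere up to a constant, as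
    q ^ n >= 1. *)
Lemma subexponential_near u : (forall n, 0 <= u n) ->
  (forall q, 1 < q -> \forall n \near \oo, u n <= q ^+ n) -> subexponential u.
Proof.
move=> u0 H q q1; have [N _ HN] := H q q1.
exists (1 + \sum_(i < N) u i) => n.
have qn : 1 <= q ^+ n by rewrite exprn_ege1// ltW.
have s0 : 0 <= \sum_(i < N) u i by rewrite sumr_ge0.
have [Nn|nN] := leqP N n.
  rewrite (le_trans (HN n Nn))// ler_peMl ?(le_trans ler01 qn)//; lra.
have : u n <= \sum_(i < N) u i.
  by rewrite (bigD1 (Ordinal nN))//= lerDl sumr_ge0.
by nra.
Qed.

Lemma subexponentialM u v : (forall n, 0 <= u n) -> (forall n, 0 <= v n) ->
  subexponential u -> subexponential v -> subexponential (fun n => u n * v n).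
Proof.
move=> u0 v0 su sv q q1; pose p := Num.sqrt q.
have q0 : 0 <= q by lra.
have p1 : 1 < p by rewrite -sqrtr1 ltr_sqrt//; lra.
have [[K HK] [L HL]] := (su p p1, sv p p1); exists (K * L) => n.
rewrite (le_trans (ler_pM (u0 n) (v0 n) (HK n) (HL n)))//.
by rewrite mulrACA -exprMn -expr2 sqr_sqrtr.
Qed.

Lemma subexponential_shift u : subexponential u ->
  subexponential (fun n => u n.+1).
Proof.
move=> su q q1; have [K HK] := su q q1; exists (K * q) => n.
by rewrite -mulrA -exprS.
Qed.

Lemma subexponentialZ a u : 0 <= a -> subexponential u ->
  subexponential (fun n => a * u n).
Proof.
move=> a0 su q q1; have [K HK] := su q q1; exists (a * K) => n.
by rewrite -mulrA ler_wpM2l.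
Qed.

Lemma subexponential_le u v : (forall n, u n <= v n) -> subexponential v ->
  subexponential u.
Proof.
move=> uv sv q q1; have [K HK] := sv q q1.
by exists K => n; exact: le_trans (uv n) (HK n).
Qed.

Lemma subexponential_natS : subexponential (fun n => n.+1%:R).
Proof.
move=> q q1; have d0 : 0 < q - 1 by lra.
have bern n : 1 + n%:R * (q - 1) <= q ^+ n.
  elim: n => [|n IH]; first by rewrite mul0r addr0 expr0.
  rewrite exprS -natr1.
  have : q * (1 + n%:R * (q - 1)) <= q * q ^+ n by rewrite ler_pM2l//; lra.
  have : 0 <= n%:R * (q - 1) * (q - 1) by rewrite !mulr_ge0// ltW.
  by nra.
exists (1 + (q - 1)^-1) => n.
have qn : 1 <= q ^+ n by rewrite exprn_ege1// ltW.
rewrite -natr1 mulrDl mul1r addrC lerD//.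
by rewrite ler_pdivlMl// mulrC; have := bern n; lra.
Qed.

Lemma subexponential_nat_exp (k : nat) :
  subexponential (fun n => n.+1%:R ^+ k).
Proof.
elim: k => [|k IH].
  by move=> q q1; exists 1 => n; rewrite expr0 mul1r exprn_ege1 ?(ltW q1).
apply: (@subexponential_le _ (fun n => n.+1%:R * n.+1%:R ^+ k)).
  by move=> n; rewrite exprS.
by apply: subexponentialM => //; exact: subexponential_natS.
Qed.

(** With q = 2 / (1 + r) > 1 the product q r is still less than 1. *)
Lemma subexponential_geometric u (r : R) : (forall n, 0 <= u n) ->
  subexponential u -> 0 <= r < 1 ->
  exists K t, [/\ 0 <= K, 0 <= t < 1 & forall n, u n * r ^+ n <= K * t ^+ n].
Proof.
move=> u0 su /andP[r0 r1]; pose q := 2 / (1 + r).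
have r1' : 0 < 1 + r by lra.
have q1 : 1 < q by rewrite ltr_pdivlMr//; lra.
have q0 : 0 < q by lra.
have [K HK] := su q q1; exists K, (q * r); split.
- by have := HK 0%N; rewrite expr0 mulr1; exact: le_trans.
- rewrite mulr_ge0 ?(ltW q0)//= /q mulrAC ltr_pdivrMr//; lra.
- by move=> n; rewrite exprMn mulrA ler_wpM2r// exprn_ge0.
Qed.

Section RootTest.
Variable alpha : nat -> R.
Hypothesis alpha_gt0 : forall n, 0 < alpha n.
Hypothesis alpha_root : (alpha n `^ (n%:R^-1)) @[n --> \oo] --> (1 : R).

Let root_powK n : (0 < n)%N -> (alpha n `^ n%:R^-1) ^+ n = alpha n.
Proof.
move=> n0; rewrite -powR_mulrn ?powR_ge0// -powRrM mulVf ?pnatr_eq0 -?lt0n//.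
by rewrite powRr1// ltW.
Qed.

Lemma subexponential_root : subexponential alpha.
Proof.
apply: subexponential_near => [n|q q1]; first exact: ltW.
have H := cvgr_lt _ alpha_root q q1.
near=> n; rewrite -(@root_powK n); last by near: n; exact: nbhs_infty_gt.
apply: lerXn2r; rewrite ?nnegrE ?powR_ge0 ?(le_trans ler01 (ltW q1))//.
by apply: ltW; near: n; exact: H.
Unshelve. all: by end_near. Qed.

Lemma subexponential_root_inv : subexponential (fun n => (alpha n)^-1).
Proof.
apply: subexponential_near => [n|q q1]; first by rewrite invr_ge0 ltW.
have q0 : 0 < q by lra.
have q1' : q^-1 < 1 by rewrite invf_lt1.
have H := cvgr_gt _ alpha_root q^-1 q1'.
near=> n; rewrite -[leRHS]invrK lef_pV2 ?posrE ?invr_gt0 ?exprn_gt0//.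
rewrite -(@root_powK n); last by near: n; exact: nbhs_infty_gt.
rewrite -exprVn; apply: lerXn2r; rewrite ?nnegrE ?powR_ge0 ?invr_ge0 ?(ltW q0)//.
by apply: ltW; near: n; exact: H.
Unshelve. all: by end_near. Qed.

End RootTest.
End Subexponential.

Section NormSums.
Local Open Scope complex_scope.
Variable R : realType.
Local Notation C := R[i].

Lemma complex_pos (x : C) : 0 < x -> exists2 r : R, 0 < r & x = r%:C.
Proof.
case: x => a b; rewrite ltcE /= => /andP[/eqP -> a0]; by exists a.
Qed.

Lemma cvg0_le (u v : nat -> R) : (forall n, 0 <= u n) ->
  (forall n, u n <= v n) -> v @ \oo --> (0 : R) -> u @ \oo --> (0 : R).
Proof.
move=> u0 uv v0; apply: (squeeze_cvgr _ (@cvg_cst _ 0 _ _ _) v0).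
by near=> n; rewrite u0 uv.
Unshelve. all: by end_near. Qed.

Lemma cvg0D (u v : nat -> R) : u @ \oo --> (0 : R) -> v @ \oo --> (0 : R) ->
  (fun n => u n + v n) @ \oo --> (0 : R).
Proof. by move=> hu hv; rewrite -(addr0 0); exact: cvgD. Qed.

Lemma cvg0Ml (c : R) (u : nat -> R) : u @ \oo --> (0 : R) ->
  (fun n => c * u n) @ \oo --> (0 : R).
Proof. by move=> hu; rewrite -(mulr0 c); exact: cvgMl_tmp. Qed.

Lemma cvg_geo0 (K t : R) : 0 <= t < 1 -> (fun n => K * t ^+ n) @ \oo --> (0 : R).
Proof.
move=> /andP[t0 t1]; rewrite -(mulr0 K); apply: cvgMl_tmp; apply: cvg_expr.
by rewrite ger0_norm.
Qed.

Section Sums.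
Variable V : normedZmodType C.
Implicit Types (a b : nat -> V) (s : V).

(** Convergence is expressed through norms in R, where the squeeze theorem and
    the order are at hand. *)
Definition sums_to a s :=
  (fun n => nrm (\sum_(i < n) a i - s)) @ \oo --> (0 : R).

Lemma sums_to_uniq a s s' : sums_to a s -> sums_to a s' -> s = s'.
Proof.
move=> h h'; apply/eqP; rewrite -subr_eq0 -nrm_eq0; apply/eqP.
have hs := cvg0D h h'.
have c : (fun _ : nat => nrm (s - s')) @ \oo --> (0 : R).
  apply: (cvg0_le _ _ hs) => n; first exact: nrm_ge0.
  rewrite (le_trans (nrm_triangle (\sum_(i < n) a i) _ _))//=.
  by rewrite lerD2r nrm_distC.
exact: (cvg_unique _ (@cvg_cst _ _ _ _ _) c).
Qed.

Lemma sums_toD a b s t : sums_to a s -> sums_to b t ->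
  sums_to (fun n => a n + b n) (s + t).
Proof.
move=> h h'; have hs := cvg0D h h'.
apply: (cvg0_le _ _ hs) => n; first exact: nrm_ge0.
by rewrite big_split /= opprD addrACA nrmD.
Qed.

Lemma sums_to_shift a s : sums_to a s -> sums_to (fun n => a n.+1) (s - a 0).
Proof.
rewrite /sums_to -cvg_shiftS => h; apply: (cvg0_le _ _ h) => n; first exact: nrm_ge0.
by rewrite /= big_ord_recl /= opprB addrA [a 0 + _]addrC.
Qed.

Lemma sums_to_finite a n : (forall i, (n <= i)%N -> a i = 0) ->
  sums_to a (\sum_(i < n) a i).
Proof.
move=> an; rewrite /sums_to; apply: cvg_near_cst.
near=> m; have mn : (n <= m)%N by near: m; exact: nbhs_infty_ge.
have -> : \sum_(i < m) a i = \sum_(i < n) a i.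
  rewrite -(subnKC mn) big_split_ord /= [X in _ + X]big1 ?addr0//.
  by move=> i _; rewrite an// leq_addr.
by rewrite subrr nrm0.
Unshelve. all: by end_near. Qed.

Lemma geometric_partial (K t : R) n : 0 <= K -> 0 <= t < 1 ->
  \sum_(i < n) K * t ^+ i <= K / (1 - t).
Proof.
move=> K0 /andP[t0 t1]; have d0 : 0 < 1 - t by lra.
rewrite ler_pdivlMr// -mulr_sumr -mulrA ler_piMr// mulrC.
have := subrX1 t n; have : 0 <= t ^+ n by rewrite exprn_ge0.
by set S := \sum_(i < n) _; lra.
Qed.

Lemma sums_to_bound a s (K t : R) : 0 <= K -> 0 <= t < 1 ->
  (forall n, nrm (a n) <= K * t ^+ n) -> sums_to a s -> nrm s <= K / (1 - t).
Proof.
move=> K0 t01 aK h; rewrite -[leRHS]add0r.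
have hs : (nrm (\sum_(i < n) a i - s) + K / (1 - t)) @[n --> \oo] -->
    (0 + K / (1 - t) : R) by apply: cvgD => //; exact: cvg_cst.
apply: (cvgr_to_ge hs); near=> n.
have := nrm_triangle (\sum_(i < n) a i) s 0; rewrite !subr0 [nrm (s - _)]nrm_distC => h1.
rewrite (le_trans h1)// lerD2l (le_trans (nrm_sum _ _ _))//.
by rewrite (le_trans _ (geometric_partial n K0 t01))// ler_sum.
Unshelve. all: by end_near. Qed.

End Sums.

Lemma sums_to_map (V W : normedZmodType C) (phi : {additive V -> W}) (M : R)
  (a : nat -> V) s :
  (forall x, nrm (phi x) <= M * nrm x) -> sums_to a s ->
  sums_to (fun n => phi (a n)) (phi s).
Proof.
move=> phiM h; have hM := cvg0Ml M h.
apply: (cvg0_le _ _ hM) => n; first exact: nrm_ge0.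
by rewrite -raddf_sum -raddfB; exact: phiM.
Qed.



Lemma sums_to_exists (V : completeNormedModType C) (a : nat -> V) (K t : R) :
  0 <= t < 1 -> (forall n, nrm (a n) <= K * t ^+ n) -> exists s, sums_to a s.
Proof.
move=> t01 aK; have /andP[t0 t1] := t01; have d0 : 0 < 1 - t by lra.
have K0 : 0 <= K.
  by have := aK 0%N; rewrite expr0 mulr1; apply: le_trans; exact: nrm_ge0.
pose s n := \sum_(i < n) a i.
have tail n m : nrm (s (n + m)%N - s n) <= K / (1 - t) * t ^+ n.
  rewrite /s big_split_ord /= addrAC subrr add0r (le_trans (nrm_sum _ _ _))//.
  rewrite mulrAC (le_trans _ (geometric_partial m (mulr_ge0 K0 (exprn_ge0 n t0)) t01))//.
  by apply: ler_sum => i _; rewrite (le_trans (aK _))// exprD mulrA.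
have tail0 := cvg_geo0 (K / (1 - t)) t01.
have : cauchy (s @ \oo).
  apply/cauchy_exP => _ /complex_pos[e e0 ->].
  have /cvgrPdist_lt/(_ e e0)[N _ HN] := tail0.
  exists (s N); exists N => // n /= Nn.
  rewrite -ball_normE /ball_ /= nrmE ltcR -(subnKC Nn) nrm_distC.
  rewrite (le_lt_trans (tail _ _))//.
  by have := HN N (leqnn N); rewrite sub0r normrN; exact: le_lt_trans (ler_norm _).
move=> /cauchy_cvg/cvg_ex[l sl]; exists l; apply/cvgrPdist_lt => e e0.
move/cvgrPdist_lt : sl => /(_ e%:C); rewrite ltcR => /(_ e0); apply: filterS => n.
by rewrite nrmE ltcR sub0r normrN ger0_norm ?nrm_ge0// nrm_distC.
Qed.

Lemma real_sums_to_exists (a : nat -> R) (K t : R) :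
  0 <= t < 1 -> (forall n, `|a n| <= K * t ^+ n) ->
  exists s, (fun n => `|\sum_(i < n) a i - s|) @ \oo --> (0 : R).
Proof.
move=> t01 aK; have : cvgn (series a).
  apply: normed_cvg; apply: (@series_le_cvg _ _ (geometric K t)) => [n|n|n|].
  - exact: normr_ge0.
  - exact: le_trans (normr_ge0 _) (aK n).
  - exact: aK.
  by apply: is_cvg_geometric_series; case/andP: t01 => t0 t1; rewrite ger0_norm.
move=> /cvg_ex[l sl]; exists l.
have : series a n - l @[n --> \oo] --> l - l by apply: cvgB => //; exact: cvg_cst.
rewrite subrr => /cvg_norm; rewrite normr0; apply: cvg_trans.
apply: near_eq_cvg; near=> n.
by rewrite /series /= big_mkord.
Unshelve. all: by end_near. Qed.

Lemma complex_sums_to_exists (a : nat -> C) (K t : R) :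
  0 <= t < 1 -> (forall n, nrm (a n) <= K * t ^+ n) -> exists s, sums_to a s.
Proof.
move=> t01 aK.
have [x hx] := real_sums_to_exists t01
  (fun n => le_trans (Re_le_nrm (a n)) (aK n)).
have [y hy] := real_sums_to_exists t01
  (fun n => le_trans (Im_le_nrm (a n)) (aK n)).
exists (x +i* y); apply: (cvg0_le _ _ (cvg0D hx hy)) => n; first exact: nrm_ge0.
rewrite (le_trans (nrm_le_ReIm _))//.
have E : \sum_(i < n) a i =
    (\sum_(i < n) complex.Re (a i)) +i* (\sum_(i < n) complex.Im (a i)).
  elim: n => [|n IH]; first by rewrite !big_ord0.
  by rewrite !big_ord_recr /= IH; case: (a n).
by rewrite E.
Qed.

End NormSums.

Section PowerSeries.
Local Open Scope complex_scope.
Variable R : realType.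
Local Notation C := R[i].
Implicit Types (a : nat -> C) (z s : C).

Definition power_sum a z s := sums_to (fun n => a n * z ^+ n) s.

Lemma power_sum_exists a z : subexponential (fun n => nrm (a n)) -> nrm z < 1 ->
  exists s, power_sum a z s.
Proof.
move=> sa z1; have [|K [t [K0 t01 H]]] := subexponential_geometric
  (fun n => nrm_ge0 (a n)) sa (r := nrm z); first by rewrite nrm_ge0.
apply: (complex_sums_to_exists t01) => n.
by rewrite nrmM nrmX; exact: H.
Qed.

Lemma sums_toZ (a : nat -> C) (k s : C) : sums_to a s ->
  sums_to (fun n => k * a n) (k * s).
Proof.
move=> h; apply: (cvg0_le _ _ (cvg0Ml (nrm k) h)) => n; first exact: nrm_ge0.
by rewrite -mulr_sumr -mulrBr nrmM.
Qed.

Lemma power_sum_shift a z s : z != 0 -> power_sum a z s ->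
  power_sum (fun n => a n.+1) z (z^-1 * (s - a 0)).
Proof.
move=> z0 /sums_to_shift; rewrite expr0 mulr1 => /(sums_toZ z^-1).
rewrite /power_sum; congr sums_to; apply/funext => n.
by rewrite exprS mulrCA mulKf.
Qed.

(* From a 0 = - z (a 1 + a 2 z + ..), where the bracket is bounded as z -> 0. *)
Let constant_term_eq0 a : subexponential (fun n => nrm (a n)) ->
  (forall z, z != 0 -> nrm z < 1 -> power_sum a z 0) -> a 0%N = 0.
Proof.
move=> sa az; have [|K [t [K0 t01 H]]] := subexponential_geometric
  (fun n => nrm_ge0 (a n.+1)) (subexponential_shift sa) (r := 2^-1).
  by apply/andP; split; lra.
have d0 : 0 < 1 - t by case/andP: t01 => _ t1; lra.
set M := K / (1 - t); have M0 : 0 <= M by rewrite divr_ge0// ltW.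
have bound z : z != 0 -> nrm z <= 2^-1 -> nrm (a 0%N) <= M * nrm z.
  move=> z0 zh; have z1 : nrm z < 1 by rewrite (le_lt_trans zh)//; lra.
  have b n : nrm (a n.+1 * z ^+ n) <= K * t ^+ n.
    rewrite nrmM nrmX (le_trans _ (H n))// ler_wpM2l ?nrm_ge0//.
    by apply: lerXn2r; rewrite ?nnegrE ?nrm_ge0// invr_ge0.
  have := sums_to_bound K0 t01 b (power_sum_shift z0 (az z z0 z1)).
  by rewrite sub0r nrmM nrmV nrmN -/M ler_pdivrMl ?nrm_gt0// mulrC.
apply/eqP; apply: contraT; rewrite -nrm_gt0; set A := nrm _ => A0.
pose x : R := Num.min 2^-1 (A / (2 * (M + 1))).
have x0 : 0 < x.
  by rewrite lt_min invr_gt0 ltr0n/= divr_gt0// mulr_gt0//; lra.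
have xh : x <= 2^-1 by rewrite ge_min lexx.
have xA : x <= A / (2 * (M + 1)) by rewrite ge_min lexx orbT.
have nx : nrm x%:C = x by rewrite nrm_real gtr0_norm.
have := bound x%:C; rewrite -nrm_gt0 nx => /(_ x0 xh) AM.
move: xA; rewrite ler_pdivlMr; last by rewrite mulr_gt0//; lra.
by nra.
Qed.

(** Dividing by z peels off one coefficient at a time. *)
Lemma power_sum_eq0 a : subexponential (fun n => nrm (a n)) ->
  (forall z, z != 0 -> nrm z < 1 -> power_sum a z 0) -> forall n, a n = 0.
Proof.
move=> sa az n; elim: n a sa az => [|n IH] a sa az.
  exact: constant_term_eq0.
apply: (IH (fun n => a n.+1)); first exact: subexponential_shift sa.
move=> z z0 z1; have := power_sum_shift z0 (az z z0 z1).
by rewrite constant_term_eq0// subr0 mulr0.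
Qed.

(** A second order remainder, as power series have, gives differentiability. *)
Lemma complex_derivable (f : C^o -> C^o) (z d : C^o) (K delta : R) : 0 < delta ->
  (forall h : C^o, nrm h <= delta -> nrm (f (z + h) - f z - d * h) <= K * nrm h ^+ 2) ->
  derivable f z 1.
Proof.
move=> d0 H; apply/cvg_ex; exists d; apply/cvgrPdist_lt => _ /complex_pos[e e0 ->].
pose K' := Num.max K 1; pose r := Num.min delta (e / (2 * K')).
have K'0 : 0 < K' by rewrite lt_max ltr01 orbT.
have r0 : 0 < r by rewrite lt_min d0 divr_gt0// mulr_gt0.
have rC : 0 < r%:C :> C by rewrite ltcR.
near=> h.
have h0 : h != 0 by near: h; exact: nbhs_dnbhs_neq.
have hr : nrm h < r.
  have : `|h| < r%:C by near: h; apply: dnbhs0_lt.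
  by rewrite nrmE ltcR.
rewrite nrmE ltcR /=.
have -> : d - h^-1 *: (f (h *: 1 + z) - f z) = - h^-1 * (f (z + h) - f z - d * h).
  rewrite /GRing.scale /= mulr1 [h + z]addrC.
  by field.
rewrite nrmM nrmN nrmV mulrC ltr_pdivrMr ?nrm_gt0//.
move: hr; rewrite lt_min => /andP[hd he].
rewrite (le_lt_trans (H h (ltW hd)))// expr2 mulrA ltr_pM2r ?nrm_gt0//.
move: he; rewrite ltr_pdivlMr ?mulr_gt0// => he.
have KK' : K * nrm h <= K' * nrm h.
  by rewrite ler_wpM2r ?nrm_ge0// le_max lexx.
by nra.
Unshelve. all: by end_near. Qed.

(* Induction through
   r_(n+1) = (z + h) r_n + n z^(n-1) h^2, where r_n is the remainder of the n-th
   power; the division by rho avoids the exponent n - 1. *)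
Let taylor_remainder (rho : R) (z h : C) n : 0 < rho -> nrm z <= rho ->
  nrm (z + h) <= rho ->
  nrm ((z + h) ^+ n.+1 - z ^+ n.+1 - n.+1%:R * z ^+ n * h) <=
    n.+1%:R ^+ 2 * rho ^+ n * (nrm h ^+ 2 / rho).
Proof.
move=> r0 zr zhr; elim: n => [|n IH].
  rewrite !expr1 expr0 mulr1 mul1r [z + h]addrC addrK subrr nrm0.
  by rewrite !mulr_ge0 ?exprn_ge0 ?nrm_ge0 ?invr_ge0 ?(ltW r0).
have -> : (z + h) ^+ n.+2 - z ^+ n.+2 - n.+2%:R * z ^+ n.+1 * h =
  (z + h) * ((z + h) ^+ n.+1 - z ^+ n.+1 - n.+1%:R * z ^+ n * h) +
  n.+1%:R * z ^+ n * h ^+ 2.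
  by rewrite !exprS -[n.+2%:R]natr1; ring.
set r := nrm h ^+ 2 / rho in IH *.
have r0' : 0 <= r by rewrite divr_ge0 ?exprn_ge0 ?nrm_ge0 ?(ltW r0).
rewrite (le_trans (nrmD _ _))// !nrmM !nrmX.
have nn : nrm (n.+1%:R : C) = n.+1%:R.
  by have := nrm_real (n.+1%:R : R); rewrite rmorph_nat ger0_norm.
have zn : nrm z ^+ n <= rho ^+ n.
  by apply: lerXn2r; rewrite ?nnegrE ?nrm_ge0// ltW.
have h1 : nrm (z + h) * nrm ((z + h) ^+ n.+1 - z ^+ n.+1 - n.+1%:R * z ^+ n * h)
  <= rho * (n.+1%:R ^+ 2 * rho ^+ n * r) by apply: ler_pM => //; exact: nrm_ge0.
have h2 : nrm (n.+1%:R : C) * nrm z ^+ n * nrm h ^+ 2 <= n.+1%:R * rho ^+ n * (rho * r).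
  have -> : rho * r = nrm h ^+ 2 by rewrite /r mulrCA mulfV ?gt_eqF// mulr1.
  by rewrite nn ler_wpM2r ?exprn_ge0 ?nrm_ge0// ler_wpM2l.
rewrite (le_trans (lerD h1 h2))//.
have p0 : 0 <= rho ^+ n * rho * r by rewrite mulr_ge0// mulr_ge0 ?exprn_ge0 ?(ltW r0).
rewrite [rho ^+ n.+1]exprSr -[n.+2%:R]natr1; set p := rho ^+ n * rho * r in p0.
have -> : rho * (n.+1%:R ^+ 2 * rho ^+ n * r) + n.+1%:R * rho ^+ n * (rho * r)
  = (n.+1%:R ^+ 2 + n.+1%:R) * p by rewrite /p; ring.
have -> : (n.+1%:R + 1) ^+ 2 * (rho ^+ n * rho) * r = (n.+1%:R + 1) ^+ 2 * p.
  by rewrite /p; ring.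
by rewrite ler_wpM2r//; have : 0 <= n.+1%:R :> R by []; nra.
Qed.

(** Termwise differentiation: the remainders of the monomials are of second
    order, with constants that are still summable inside the disk. *)
Lemma power_sum_derivable a (f : C^o -> C^o) :
  subexponential (fun n => nrm (a n)) ->
  (forall z, nrm z < 1 -> power_sum a z (f z)) ->
  forall z, nrm z < 1 -> derivable f z 1.
Proof.
move=> sa fa z z1; pose rho := (1 + nrm z) / 2.
have z0 := nrm_ge0 z.
have rho0 : 0 < rho by rewrite /rho; lra.
have rho1 : rho < 1 by rewrite /rho; lra.
have zrho : nrm z <= rho by rewrite /rho; lra.
have sb : subexponential (fun n => n.+1%:R ^+ 2 * nrm (a n.+1)).
  apply: subexponentialM => [n|n||]; [by rewrite exprn_ge0|exact: nrm_ge0| |].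
    exact: subexponential_nat_exp.
  exact: subexponential_shift sa.
have [|d dP] := @power_sum_exists (fun n => n.+1%:R * a n.+1) z _ z1.
  apply: subexponential_le sb => n; rewrite nrmM.
  have := nrm_real (n.+1%:R : R); rewrite rmorph_nat ger0_norm// => ->.
  by rewrite ler_wpM2r ?nrm_ge0// expr2 ler_peMr// ler1n.
have [n||K [t [K0 t01 H]]] := subexponential_geometric (r := rho) _ sb.
- by rewrite mulr_ge0 ?exprn_ge0 ?nrm_ge0.
- by rewrite rho1 ltW.
apply: (@complex_derivable _ _ d (K / rho / (1 - t)) ((1 - nrm z) / 2)); first lra.
move=> h hd.
have zh : nrm (z + h) <= rho by rewrite (le_trans (nrmD _ _))// /rho; lra.
have zh1 : nrm (z + h) < 1 by exact: le_lt_trans rho1.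
have S1 := sums_to_shift (fa _ zh1).
have S2 := sums_to_shift (fa _ z1).
have S3 := sums_toZ h dP.
have hrho : 0 <= nrm h ^+ 2 / rho by rewrite divr_ge0 ?exprn_ge0 ?nrm_ge0 ?(ltW rho0).
have := sums_to_bound (mulr_ge0 K0 hrho) t01 _
  (sums_toD (sums_toD S1 (sums_toZ (-1) S2)) (sums_toZ (-1) S3)).
rewrite (_ : _ + _ + -1 * (h * d) = f (z + h) - f z - d * h); last first.
  by rewrite !expr0; ring.
rewrite (_ : K / rho / (1 - t) * nrm h ^+ 2 = K * (nrm h ^+ 2 / rho) / (1 - t)).
  apply=> n.
  rewrite (_ : _ + _ = a n.+1 *
      ((z + h) ^+ n.+1 - z ^+ n.+1 - n.+1%:R * z ^+ n * h)); last by ring.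
  rewrite nrmM [leRHS]mulrAC (le_trans _ (ler_wpM2r hrho (H n)))//.
  rewrite [leRHS](_ : _ = nrm (a n.+1) *
      (n.+1%:R ^+ 2 * rho ^+ n * (nrm h ^+ 2 / rho))); last by ring.
  by rewrite ler_wpM2l ?nrm_ge0// taylor_remainder.
by ring.
Qed.

End PowerSeries.

(** * Derivatives and primitives along real paths *)

Section ComplexLimits.
Local Open Scope complex_scope.
Variable R : realType.
Local Notation C := R[i].

Lemma cvg_nrmP (T : Type) (F : set_system T) {FF : Filter F} (f : T -> C^o) (l : C^o) :
  f @ F --> l <-> forall e : R, 0 < e -> \forall x \near F, nrm (l - f x) < e.
Proof.
split=> [/cvgrPdist_lt H e e0|H].
  have := H e%:C; rewrite ltcR => /(_ e0); apply: filterS => x.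
  by rewrite nrmE ltcR.
apply/cvgrPdist_lt => _ /complex_pos[e e0 ->].
by have := H e e0; apply: filterS => x; rewrite nrmE ltcR.
Qed.

Lemma cvg_Re (T : Type) (F : set_system T) {FF : Filter F} (f : T -> C^o) (l : C^o) :
  f @ F --> l -> (fun x => complex.Re (f x)) @ F --> complex.Re l.
Proof.
move/cvg_nrmP => H; apply/cvgrPdist_lt => e e0; have := H e e0.
apply: filterS => x; apply: le_lt_trans.
by have := Re_le_nrm (l - f x); rewrite raddfB.
Qed.

Lemma cvg_Im (T : Type) (F : set_system T) {FF : Filter F} (f : T -> C^o) (l : C^o) :
  f @ F --> l -> (fun x => complex.Im (f x)) @ F --> complex.Im l.
Proof.
move/cvg_nrmP => H; apply/cvgrPdist_lt => e e0; have := H e e0.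
apply: filterS => x; apply: le_lt_trans.
by have := Im_le_nrm (l - f x); rewrite raddfB.
Qed.

Lemma cvg_complex (T : Type) (F : set_system T) {FF : Filter F} (u v : T -> R) (a b : R) :
  u @ F --> a -> v @ F --> b -> (fun x => u x +i* v x : C^o) @ F --> (a +i* b : C^o).
Proof.
move=> /cvgrPdist_lt hu /cvgrPdist_lt hv; apply/cvg_nrmP => e e0.
have e20 : 0 < e / 2 by lra.
apply: filterS2 (hu _ e20) (hv _ e20) => x h1 h2.
by rewrite (le_lt_trans (nrm_le_ReIm _))//=; lra.
Qed.

Lemma cvg_nrm (T : Type) (F : set_system T) {FF : Filter F} (f : T -> C^o) (l : C^o) :
  f @ F --> l -> (fun x => nrm (f x)) @ F --> nrm l.
Proof.
move/cvg_nrmP => H; apply/cvgrPdist_lt => e e0; have := H e e0.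
apply: filterS => x h; rewrite (le_lt_trans _ h)// ler_norml.
have := ler_sub_nrm (f x) l; rewrite nrm_distC => h1.
by rewrite ler_sub_nrm andbT; lra.
Qed.

End ComplexLimits.

Section PathDerivatives.
Local Open Scope complex_scope.
Variable R : realType.
Local Notation C := R[i].

(** Complex valued functions of a real variable; as C is normed over itself and
    not over R, their derivative is given by first order expansions. *)
Definition path_derive (p : R -> C) (x : R) (v : C) :=
  forall e, 0 < e -> exists2 d, 0 < d & forall h : R, `|h| < d ->
    nrm (p (x + h) - p x - h%:C * v) <= e * `|h|.

Lemma path_deriveD p q x v w : path_derive p x v -> path_derive q x w ->
  path_derive (fun t => p t + q t) x (v + w).
Proof.
move=> hp hq e e0; have e20 : 0 < e / 2 by lra.
have [[d d0 H] [d' d'0 H']] := (hp _ e20, hq _ e20).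
exists (Num.min d d'); first by rewrite lt_min d0.
move=> h; rewrite lt_min => /andP[/H h1 /H' h2].
rewrite (_ : _ - _ - _ = (p (x + h) - p x - h%:C * v) +
  (q (x + h) - q x - h%:C * w)); last by ring.
by rewrite (le_trans (nrmD _ _))//; lra.
Qed.

Lemma path_deriveZ c p x v : path_derive p x v ->
  path_derive (fun t => c * p t) x (c * v).
Proof.
move=> hp e e0; have c0 : 0 < nrm c + 1 by have := nrm_ge0 c; lra.
have [|d d0 H] := hp (e / (nrm c + 1)); first by rewrite divr_gt0.
exists d => // h /H {}H.
rewrite (_ : _ - _ = c * (p (x + h) - p x - h%:C * v)); last by ring.
rewrite nrmM; have : (nrm c + 1) * nrm (p (x + h) - p x - h%:C * v) <= e * `|h|.
  by rewrite -ler_pdivlMl// mulrA [_^-1 * _]mulrC.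
by have := nrm_ge0 (p (x + h) - p x - h%:C * v); nra.
Qed.

Lemma path_deriveB p q x v w : path_derive p x v -> path_derive q x w ->
  path_derive (fun t => p t - q t) x (v - w).
Proof.
move=> hp /(path_deriveZ (-1)) hq; have := path_deriveD hp hq.
rewrite mulN1r; congr (path_derive _ _ _); apply/funext => t.
by rewrite mulN1r.
Qed.

Lemma real_derive_eps (f : R -> R) (x v : R) : is_derive x 1 f v <->
  forall e, 0 < e -> exists2 d, 0 < d & forall h : R, `|h| < d ->
    `|f (x + h) - f x - h * v| <= e * `|h|.
Proof.
split=> [[dfx dv] e e0|H].
  have : (fun h : R => h^-1 *: ((f \o shift x) (h *: 1) - f x)) @ 0^' --> v.
    by rewrite -dv; exact: dfx.
  move=> /cvgrPdist_le/(_ e e0)[d /= d0 H]; exists d => // h hd.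
  have [->|h0] := eqVneq h 0; first by rewrite addr0 subrr mul0r subr0 normr0 mulr0.
  have := H h; rewrite /= sub0r normrN => /(_ hd h0).
  rewrite /GRing.scale /= mulr1 [h + x]addrC -ler_pdivrMr ?normr_gt0//.
  apply: le_trans; rewrite -normfV -normrM distrC.
  by rewrite (_ : _ * h^-1 = h^-1 * (f (x + h) - f x) - v)//; field.
have L : (fun h : R => h^-1 *: ((f \o shift x) (h *: 1) - f x)) @ 0^' --> v.
  apply/cvgrPdist_le => e e0; have [d d0 {}H] := H e e0.
  exists d => // h; rewrite /= sub0r normrN => hd h0.
  rewrite /GRing.scale /= mulr1 [h + x]addrC distrC.
  rewrite (_ : _ - v = (f (x + h) - f x - h * v) * h^-1); last by field.
  by rewrite normrM normfV ler_pdivrMr ?normr_gt0// H.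
by apply: DeriveDef; [apply/cvg_ex; exists v|exact: cvg_lim].
Qed.

Lemma path_derive_Re p x v : path_derive p x v ->
  is_derive x 1 (fun t => complex.Re (p t)) (complex.Re v).
Proof.
move=> hp; apply/real_derive_eps => e e0; have [d d0 H] := hp e e0.
exists d => // h /H; apply: le_trans; apply: le_trans (Re_le_nrm _).
by case: (p _) => a b; case: (p x) => a' b'; case: (v) => a'' b'' /=; rewrite mul0r subr0.
Qed.

Lemma path_derive_complex (u w : R -> R) (x a b : R) :
  is_derive x 1 u a -> is_derive x 1 w b ->
  path_derive (fun t => u t +i* w t) x (a +i* b).
Proof.
move=> /real_derive_eps hu /real_derive_eps hw e e0.
have e20 : 0 < e / 2 by lra.
have [[d d0 H] [d' d'0 H']] := (hu _ e20, hw _ e20).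
exists (Num.min d d'); first by rewrite lt_min d0.
move=> h; rewrite lt_min => /andP[/H h1 /H' h2].
rewrite (le_trans (nrm_le_ReIm _))//=; rewrite !mul0r subr0 addr0.
by lra.
Qed.

(** Rotating the increment onto the positive real axis reduces this to the
    mean value theorem for a real valued function. *)
Lemma mean_value_bound p (F : R -> C) a b M : a <= b ->
  (forall x, a <= x <= b -> path_derive p x (F x)) ->
  (forall x, a <= x <= b -> nrm (F x) <= M) ->
  nrm (p b - p a) <= M * (b - a).
Proof.
rewrite le_eqVlt => /predU1P[<- _ _|ab hp FM]; first by rewrite !subrr nrm0 mulr0.
have [E|n0] := eqVneq (p b - p a) 0.
  rewrite E nrm0 mulr_ge0//; last lra.
  by apply: le_trans (FM a _); rewrite ?nrm_ge0// lexx ltW.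
pose c := (nrm (p b - p a))%:C / (p b - p a).
have nn0 : nrm (p b - p a) != 0 by rewrite nrm_eq0.
have c1 : nrm c = 1 by rewrite nrmM nrmV nrm_real ger0_norm ?nrm_ge0// mulfV.
have cE : c * (p b - p a) = (nrm (p b - p a))%:C by rewrite /c divfK.
have hq x : a <= x <= b ->
    is_derive x 1 (fun t => complex.Re (c * p t)) (complex.Re (c * F x)).
  by move=> xab; apply: path_derive_Re; apply: path_deriveZ; exact: hp.
have [x||x xab E] := MVT_segment (ltW ab) (f := fun t => complex.Re (c * p t))
    (df := fun x => complex.Re (c * F x)).
- by rewrite in_itv/= => /andP[xa xb]; apply: hq; rewrite !ltW.
- apply: derivable_within_continuous => x; rewrite in_itv/= => xab.
  by have [] := hq x xab.
have -> : nrm (p b - p a) = complex.Re (c * F x) * (b - a).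
  by rewrite -E -raddfB /= -mulrBr cE.
rewrite ler_wpM2r//; first lra.
rewrite (le_trans (ler_norm _))// (le_trans (Re_le_nrm _))// nrmM c1 mul1r.
by apply: FM; move: xab; rewrite in_itv.
Qed.

Lemma primitive_exists (F : R -> C^o) a b :
  (forall x, a < x < b -> {for x, continuous F}) ->
  forall c d, a < c -> d < b ->
  exists p, forall x, c <= x <= d -> path_derive p x (F x).
Proof.
move=> cF c d ac db; pose a' := (a + c) / 2; pose b' := (d + b) / 2.
have real (f : R -> R) : (forall x, a < x < b -> {for x, continuous f}) ->
    exists P, forall x, c <= x <= d -> is_derive x 1 P (f x).
  move=> cf; exists (fun x => \int[lebesgue_measure]_(t in `[a', x]) f t)%R => x /andP[cx xd].
  have intf : lebesgue_measure.-integrable `[a', b'] (EFin \o f).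
    apply: continuous_compact_integrable; first exact: segment_compact.
    apply: continuous_in_subspaceT => y; rewrite inE /= in_itv/= => /andP[y1 y2].
    by apply: cf; rewrite /a' /b' in y1 y2; lra.
  have [||| dP dE] := continuous_FTC1_closed (x := x) _ intf.
  - by rewrite /b'; lra.
  - by rewrite /a'; lra.
  - by apply: cf; lra.
  by apply: DeriveDef; [exact: dP|rewrite -derive1E; exact: dE].
have [P hP] := real _ (fun x xab => cvg_Re (cF x xab)).
have [Q hQ] := real _ (fun x xab => cvg_Im (cF x xab)).
exists (fun t => P t +i* Q t) => x xcd.
have := path_derive_complex (hP x xcd) (hQ x xcd).
by case: (F x).
Qed.

End PathDerivatives.

(** * Complex derivatives and nested rectangles *)

Section ComplexDerivative.
Local Open Scope complex_scope.
Variable R : realType.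
Local Notation C := R[i].
Implicit Types (G H : C -> C) (w z d : C).

Definition complex_derive G w d :=
  forall e : R, 0 < e -> exists2 del : R, 0 < del & forall h, nrm h < del ->
    nrm (G (w + h) - G w - d * h) <= e * nrm h.

Lemma derivable_complex_derive (f : C^o -> C^o) (z : C^o) :
  derivable f z 1 -> exists d, complex_derive f z d.
Proof.
move=> /cvg_ex[d /cvgrPdist_le L]; exists d => e e0.
have e0C : 0 < e%:C :> C by rewrite ltcR.
have [_ /= /complex_pos[del del0 ->] H] := L _ e0C.
exists del => // h hd.
have [->|h0] := eqVneq h 0; first by rewrite addr0 subrr mulr0 subr0 nrm0 mulr0.
have := H h; rewrite /= sub0r normrN nrmE ltcR => /(_ hd h0).
rewrite /GRing.scale /= mulr1 [h + z]addrC nrmE lecR.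
rewrite -ler_pdivrMr ?nrm_gt0//; apply: le_trans; rewrite -nrmV -nrmM nrm_distC.
by rewrite (_ : _ * h^-1 = h^-1 * (f (z + h) - f z) - d)//; field.
Qed.

Lemma complex_derive_continuous G w d : complex_derive G w d ->
  {for w, continuous (G : C^o -> C^o)}.
Proof.
move=> hG; apply/(cvg_nrmP (F := nbhs (w : C^o))) => e e0.
have [del del0 H] := hG 1 ltr01; have d0 := nrm_ge0 d.
near=> y; pose h : C := y - w.
have hd : nrm h < Num.min del (e / (nrm d + 2)).
  have : ball (w : C^o) (Num.min del (e / (nrm d + 2)))%:C y.
    by near: y; apply: nbhsx_ballx; rewrite ltcR lt_min del0 divr_gt0//; lra.
  by rewrite -ball_normE /= distrC nrmE ltcR.
move: hd; rewrite lt_min => /andP[/H + he].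
rewrite /h [w + _]addrC subrK => h1; rewrite nrm_distC.
have := ler_sub_nrm (G y - G w) (d * (y - w)); rewrite nrmM.
move: he; rewrite ltr_pdivlMr; last lra.
by have := nrm_ge0 (y - w); rewrite /h; nra.
Unshelve. all: by end_near. Qed.

Lemma complex_derive_lipschitz G w d : complex_derive G w d ->
  exists2 del : R, 0 < del & forall h, nrm h < del ->
    nrm (G (w + h) - G w) <= (nrm d + 1) * nrm h.
Proof.
move=> /(_ 1 ltr01)[del del0 H]; exists del => // h /H h1.
have := ler_sub_nrm (G (w + h) - G w) (d * h); rewrite nrmM; lra.
Qed.

(* M is a local Lipschitz constant of G at w, and M' one of the linear part of H;
   each of the two error terms receives half of e. *)
Lemma complex_derive_comp G H w d d' : complex_derive G w d ->
  complex_derive H (G w) d' -> complex_derive (fun x => H (G x)) w (d' * d).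
Proof.
move=> hG hH e e0; have [del0 del00 lip] := complex_derive_lipschitz hG.
have d0 := nrm_ge0 d; have d'0 := nrm_ge0 d'.
pose M := nrm d + 1; have M0 : 0 < M by rewrite /M; lra.
pose M' := nrm d' + 1; have M'0 : 0 < M' by rewrite /M'; lra.
have [|del1 del10 H1] := hH (e / (2 * M)); first by rewrite divr_gt0 ?mulr_gt0.
have [|del2 del20 H2] := hG (e / (2 * M')); first by rewrite divr_gt0 ?mulr_gt0.
exists (Num.min (Num.min del0 del2) (del1 / M)).
  by rewrite !lt_min del00 del20 divr_gt0.
move=> h; rewrite !lt_min => /andP[/andP[/lip h0 /H2 h2] h1].
pose k := G (w + h) - G w.
have Gk : G (w + h) = G w + k by rewrite /k [G w + _]addrC subrK.
have hk : nrm k < del1.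
  by rewrite (le_lt_trans h0)// -/M mulrC -ltr_pdivlMr.
rewrite (_ : _ - _ - _ = (H (G w + k) - H (G w) - d' * k) +
    d' * (k - d * h)); last by rewrite Gk; ring.
rewrite (le_trans (nrmD _ _))// nrmM.
have n0 := nrm_ge0 h; have nk := nrm_ge0 (k - d * h).
have h3 : nrm (H (G w + k) - H (G w) - d' * k) <= e / 2 * nrm h.
  rewrite (le_trans (H1 k hk))//.
  have : e / (2 * M) * nrm k <= e / (2 * M) * (M * nrm h).
    by rewrite ler_wpM2l// divr_ge0 ?mulr_ge0 ?(ltW e0) ?(ltW M0).
  move=> /le_trans; apply; rewrite le_eqVlt; apply/orP; left; apply/eqP.
  by field; rewrite gt_eqF.
have h4 : M' * nrm (k - d * h) <= e / 2 * nrm h.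
  rewrite -ler_pdivlMl//; apply: le_trans h2 _; rewrite le_eqVlt; apply/orP; left.
  by apply/eqP; field; rewrite gt_eqF.
have : nrm d' * nrm (k - d * h) <= M' * nrm (k - d * h).
  by rewrite ler_wpM2r// /M'; lra.
by lra.
Qed.

End ComplexDerivative.

Section Bisection.
Local Open Scope complex_scope.
Variable R : realType.
Local Notation C := R[i].
Variable mu : R -> R -> R -> R -> C.
Hypothesis mu_splitl : forall m s s' t t',
  mu s s' t t' = mu s m t t' + mu m s' t t'.
Hypothesis mu_splitr : forall m s s' t t',
  mu s s' t t' = mu s s' t m + mu s s' m t'.

(* q is the rectangle (s, t, l, k) = [s, s + l] x [t, t + k]; the lower left
   corner of a quarter that keeps a quarter of the modulus of mu is returned. *)
Let quarter (q : R * R * R * R) : exists xy : R * R, let: (s, t, l, k) := q in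
  [/\ xy.1 = s \/ xy.1 = s + l / 2, xy.2 = t \/ xy.2 = t + k / 2 &
    nrm (mu s (s + l) t (t + k)) <=
      4 * nrm (mu xy.1 (xy.1 + l / 2) xy.2 (xy.2 + k / 2))].
Proof.
case: q => [[[s t] l] k].
pose f x y := nrm (mu x (x + l / 2) y (y + k / 2)).
have half (a b : R) : a + b / 2 + b / 2 = a + b by field.
have total : nrm (mu s (s + l) t (t + k)) <=
    f s t + f s (t + k / 2) + (f (s + l / 2) t + f (s + l / 2) (t + k / 2)).
  rewrite (mu_splitl (s + l / 2)) (le_trans (nrmD _ _))//.
  rewrite (mu_splitr (t + k / 2) s) (mu_splitr (t + k / 2) (s + l / 2)).
  by rewrite /f !half lerD// nrmD.
apply: contrapT => nex.
have small x y : x = s \/ x = s + l / 2 -> y = t \/ y = t + k / 2 ->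
    4 * f x y < nrm (mu s (s + l) t (t + k)).
  move=> hx hy; rewrite ltNge; apply/negP => h; apply: nex.
  by exists (x, y).
have := small s t (or_introl erefl) (or_introl erefl).
have := small s (t + k / 2) (or_introl erefl) (or_intror erefl).
have := small (s + l / 2) t (or_intror erefl) (or_introl erefl).
have := small (s + l / 2) (t + k / 2) (or_intror erefl) (or_intror erefl).
lra.
Qed.

(** An additive function of rectangles whose density is zero at every point
    vanishes: otherwise some quarter always keeps a quarter of its modulus, and
    these nested quarters shrink to a point where the density is not zero. *)
Lemma bisection_vanishing c t0 L T : 0 <= L -> 0 <= T ->
  (forall x y, c <= x <= c + L -> t0 <= y <= t0 + T ->
    forall e, 0 < e -> exists2 del, 0 < del & forall s s' t t',
      c <= s <= x -> x <= s' <= c + L -> t0 <= t <= y -> y <= t' <= t0 + T ->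
      s' - s < del -> t' - t < del ->
      nrm (mu s s' t t') <= e * ((s' - s) + (t' - t)) ^+ 2) ->
  mu c (c + L) t0 (t0 + T) = 0.
Proof.
move=> L0 T0 local.
have [F FP] := choice quarter.
pose l n : R := L * 2^-1 ^+ n; pose k n : R := T * 2^-1 ^+ n.
pose P := fix P n := if n is m.+1
  then F ((P m).1, (P m).2, l m, k m) else (c, t0).
pose x n := (P n).1; pose y n := (P n).2.
have lS n : l n.+1 = l n / 2 by rewrite /l exprSr mulrA.
have kS n : k n.+1 = k n / 2 by rewrite /k exprSr mulrA.
have l0 n : 0 <= l n by rewrite mulr_ge0// exprn_ge0// invr_ge0.
have k0 n : 0 <= k n by rewrite mulr_ge0// exprn_ge0// invr_ge0.
have step n := FP (x n, y n, l n, k n).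
have xS n : x n <= x n.+1 /\ x n.+1 + l n.+1 <= x n + l n.
  by have [h _ _] := step n; rewrite lS; have := l0 n; case: h; rewrite -/(x n.+1) => ->; lra.
have yS n : y n <= y n.+1 /\ y n.+1 + k n.+1 <= y n + k n.
  by have [_ h _] := step n; rewrite kS; have := k0 n; case: h; rewrite -/(y n.+1) => ->; lra.
have muS n : nrm (mu c (c + L) t0 (t0 + T)) <=
    4 ^+ n * nrm (mu (x n) (x n + l n) (y n) (y n + k n)).
  elim: n => [|n IH]; first by rewrite expr0 mul1r /l /k !expr0 !mulr1.
  rewrite (le_trans IH)// exprSr -mulrA ler_wpM2l ?exprn_ge0//.
  by have [_ _] := step n; rewrite lS kS.
have nested (u v : nat -> R) : (forall n, 0 <= v n) ->
    (forall n, u n <= u n.+1 /\ u n.+1 + v n.+1 <= u n + v n) ->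
    exists p, forall n, u n <= p <= u n + v n.
  move=> v0 uS.
  have mono m n : u m <= u (m + n)%N /\ u (m + n)%N + v (m + n)%N <= u m + v m.
    elim: n => [|n [h1 h2]]; first by rewrite addn0.
    by rewrite addnS; have [h3 h4] := uS (m + n)%N; split; lra.
  have cross m n : u m <= u n + v n.
    have [h1 _] := mono m n; have [_ h2] := mono n m.
    by rewrite addnC in h2; have := v0 (m + n)%N; lra.
  have ub : has_ubound (range u) by exists (u 0%N + v 0%N) => _ [m _ <-].
  exists (sup (range u)) => n; apply/andP; split.
    by apply: ub_le_sup => //; exists n.
  by apply: ge_sup; [exists (u 0%N); exists 0%N|move=> _ [m _ <-]].
have [p pP] := nested x l l0 xS; have [q qP] := nested y k k0 yS.
have xc n : c <= x n.
  by elim: n => [|n IH]; [rewrite /x|have [] := xS n; lra].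
have xL n : x n + l n <= c + L.
  by elim: n => [|n IH]; [rewrite /x /l /= expr0 mulr1|have [] := xS n; lra].
have yc n : t0 <= y n.
  by elim: n => [|n IH]; [rewrite /y|have [] := yS n; lra].
have yT n : y n + k n <= t0 + T.
  by elim: n => [|n IH]; [rewrite /y /k /= expr0 mulr1|have [] := yS n; lra].
apply/eqP; rewrite -nrm_eq0; apply/negPn/negP => mu_neq0.
set m := nrm _ in mu_neq0 muS.
have m0 : 0 < m by rewrite lt_def mu_neq0 nrm_ge0.
pose A := (L + T) ^+ 2; have A0 : 0 <= A by rewrite exprn_ge0// addr_ge0.
have pc : c <= p <= c + L.
  by have := pP 0%N; have := xc 0%N; have := xL 0%N; lra.
have qc : t0 <= q <= t0 + T.
  by have := qP 0%N; have := yc 0%N; have := yT 0%N; lra.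
have e0 : 0 < m / (A + 1) by rewrite divr_gt0//; lra.
have [del del0 H] := local p q pc qc _ e0.
have /cvgrPdist_lt/(_ _ del0)[N _ HN] :
    (fun n => (L + T) * 2^-1 ^+ n) @ \oo --> (0 : R).
  by apply: cvg_geo0; lra.
have := HN N (leqnn N); rewrite sub0r normrN ger0_norm; last first.
  by rewrite mulr_ge0 ?addr_ge0// exprn_ge0// invr_ge0.
rewrite mulrDl -/(l N) -/(k N) => lk.
have := H (x N) (x N + l N) (y N) (y N + k N).
rewrite ![_ + _ - _]addrAC !subrr !add0r.
have l0N := l0 N; have k0N := k0 N.
move=> HH.
have {HH} : nrm (mu (x N) (x N + l N) (y N) (y N + k N)) <=
    m / (A + 1) * (l N + k N) ^+ 2.
  have /andP[p1 p2] := pP N; have /andP[q1 q2] := qP N.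
  by apply: HH; rewrite ?xc ?xL ?yc ?yT ?p1 ?p2 ?q1 ?q2//; clear -lk l0N k0N; lra.
have -> : (l N + k N) ^+ 2 = A / 4 ^+ N.
  rewrite /l /k -mulrDl exprMn -/A -exprM mulnC exprM -exprVn; congr (_ * _ ^+ _).
  by rewrite exprVn; congr (_^-1); ring.
move=> h; have := muS N; rewrite leNgt => /negP; apply.
have q0 : 0 < 4 ^+ N :> R by rewrite exprn_gt0.
rewrite mulrC -ltr_pdivlMr//; apply: le_lt_trans h _.
rewrite mulrA ltr_pM2r ?invr_gt0// mulrAC ltr_pdivrMr; last lra.
by rewrite ltr_pM2l//; lra.
Qed.

End Bisection.

(** * Goursat's lemma *)

Section Goursat.
Local Open Scope complex_scope.
Variable R : realType.
Local Notation C := R[i].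

Definition cpt (s t : R) : C := s +i* t.

Lemma nrm_cpt_sub s t s' t' : nrm (cpt s t - cpt s' t') <= `|s - s'| + `|t - t'|.
Proof. by rewrite (le_trans (nrm_le_ReIm _)). Qed.

Lemma cpt_shiftl s t h : cpt (s + h) t = cpt s t + h%:C * 1.
Proof. by apply/eqP; rewrite mulr1 eq_complex /= addr0 !eqxx. Qed.

Lemma cpt_shiftr s t h : cpt s (t + h) = cpt s t + h%:C * 'i.
Proof.
by apply/eqP; rewrite eq_complex /=; apply/andP; split; apply/eqP; ring.
Qed.

(** An affine function b + d w has the primitive b w + d w^2 / 2, whatever the
    direction v in which the line is run through. *)
Lemma affine_primitive (b d v : C) (x : R) (p : R -> C) :
  (forall h, p (x + h) = p x + h%:C * v) ->
  path_derive (fun t => b * p t + d / 2 * p t ^+ 2) x (v * (b + d * p x)).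
Proof.
move=> pE e e0; pose M := nrm (d / 2 * v ^+ 2) + 1.
have M0 : 0 < M by have := nrm_ge0 (d / 2 * v ^+ 2); rewrite /M; lra.
exists (e / M); first by rewrite divr_gt0.
move=> h; rewrite ltr_pdivlMr// => hM; rewrite pE.
rewrite (_ : _ - _ = h%:C ^+ 2 * (d / 2 * v ^+ 2)); last by field.
rewrite nrmM nrmX nrm_real.
have : nrm (d / 2 * v ^+ 2) <= M by rewrite /M; lra.
have := normr_ge0 h; have := nrm_ge0 (d / 2 * v ^+ 2); nra.
Qed.

Variables (G : C -> C) (sig1 sig2 c d T : R).
Hypothesis cd : c <= d.
Hypothesis T0 : 0 <= T.
Hypothesis sig1c : sig1 < c.
Hypothesis dsig2 : d < sig2.
Hypothesis G_derive : forall s t, sig1 < s < sig2 ->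
  exists D, complex_derive G (cpt s t) D.

Let G_continuous_h t s : sig1 < s < sig2 ->
  {for s, continuous (fun x => G (cpt x t) : C^o)}.
Proof.
move=> ssig; have [D hD] := G_derive t ssig.
apply: (continuous_comp (f := fun x => cpt x t : C^o)); last first.
  exact: complex_derive_continuous hD.
by apply: cvg_complex; [exact: cvg_id|exact: cvg_cst].
Qed.

Let G_continuous_v s t : sig1 < s < sig2 ->
  {for t, continuous (fun y => G (cpt s y) : C^o)}.
Proof.
move=> ssig; have [D hD] := G_derive t ssig.
apply: (continuous_comp (f := fun y => cpt s y : C^o)); last first.
  exact: complex_derive_continuous hD.
by apply: cvg_complex; [exact: cvg_cst|exact: cvg_id].
Qed.

Lemma vertical_primitive s : sig1 < s < sig2 -> exists p, forall t,
  0 <= t <= T -> path_derive p t (G (cpt s t)).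
Proof.
move=> ssig; apply: (@primitive_exists R _ (-1) (T + 1)); try lra.
by move=> t _; exact: G_continuous_v.
Qed.

Lemma horizontal_primitive t : exists p, forall s,
  c <= s <= d -> path_derive p s (G (cpt s t)).
Proof.
apply: (@primitive_exists R _ sig1 sig2) => // s ssig.
exact: G_continuous_h.
Qed.

(** The integral of G along the boundary of a rectangle is written with
    primitives Phi and Psi of G along vertical and horizontal lines, so that its
    additivity is an identity. Near a point, G is affine up to a small error,
    and the boundary integral of an affine function is zero. *)
Theorem goursat :
  exists (Phi Psi : R -> R -> C),
  [/\ forall s t, c <= s <= d -> 0 <= t <= T -> path_derive (Phi s) t (G (cpt s t)),
      forall t s, c <= s <= d -> path_derive (Psi t) s (G (cpt s t)) &
      (Psi 0 d - Psi 0 c) + 'i * (Phi d T - Phi d 0) =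
      (Psi T d - Psi T c) + 'i * (Phi c T - Phi c 0)].
Proof.
move: (cd) (T0) (sig1c) (dsig2) => cd0 T00 sc0 ds0.
have [Psi hPsi] := choice horizontal_primitive.
have /choice[Phi hPhi] : forall s, exists p, c <= s <= d -> forall t,
    0 <= t <= T -> path_derive p t (G (cpt s t)).
  move=> s; have [scd|ns] := boolP (c <= s <= d); last by exists (fun=> 0).
  by have [|p hp] := @vertical_primitive s; [lra|exists p].
exists Phi, Psi; split => [s t scd tT|t s scd|]; [exact: hPhi|exact: hPsi|].
pose mu s s' t t' := (Psi t s' - Psi t s) + 'i * (Phi s' t' - Phi s' t)
  - (Psi t' s' - Psi t' s) - 'i * (Phi s t' - Phi s t).
suff : mu c (c + (d - c)) 0 (0 + T) = 0.
  rewrite add0r (addrC c) subrK /mu => /eqP.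
  by rewrite -addrA -opprD subr_eq0 => /eqP.
apply: bisection_vanishing => [m s s' t t'|m s s' t t'|||x y xcd yT e e0];
  [by rewrite /mu; ring|by rewrite /mu; ring|lra|by []|].
have xcd' : c <= x <= d by lra.
have [|D hD] := @G_derive x y; first lra.
pose p := cpt x y.
have e40 : 0 < e / 4 by lra.
have [del del0 H] := hD _ e40.
exists (del / 2); first lra.
move=> s s' t t' sx xs' ty yt' sdel tdel.
pose b := G p - D * p; pose A (w : C) := b * w + D / 2 * w ^+ 2.
pose ell := (s' - s) + (t' - t).
have rest u v : s <= u <= s' -> t <= v <= t' ->
    nrm (G (cpt u v) - (b + D * cpt u v)) <= e / 4 * ell.
  move=> us vt; have n1 := nrm_cpt_sub u v x y; rewrite -/p in n1.
  have n2 : `|u - x| + `|v - y| <= ell.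
    by rewrite /ell lerD// ler_norml; lra.
  have := H (cpt u v - p); rewrite -/p [p + _]addrC subrK.
  rewrite (_ : G (cpt u v) - G p - D * (cpt u v - p) =
    G (cpt u v) - (b + D * cpt u v)); last by rewrite /b; ring.
  move=> h; apply: le_trans (h _) _; first by rewrite /ell in n2 *; lra.
  by rewrite ler_wpM2l//; lra.
(* A is a primitive of the affine part, so it cancels around the boundary. *)
have hor v : t <= v <= t' ->
    nrm ((Psi v s' - Psi v s) - (A (cpt s' v) - A (cpt s v))) <= e / 4 * ell * (s' - s).
  move=> vt; pose q u := Psi v u - A (cpt u v).
  rewrite (_ : _ - _ = q s' - q s); last by rewrite /q; ring.
  apply: (@mean_value_bound R q (fun u => G (cpt u v) - 1 * (b + D * cpt u v))).
  - lra.
  - move=> u us; apply: path_deriveB; first by apply: hPsi; lra.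
    by apply: affine_primitive => // h; exact: cpt_shiftl.
  - by move=> u us; rewrite mul1r; exact: rest.
have ver u : s <= u <= s' ->
    nrm ('i * (Phi u t' - Phi u t) - (A (cpt u t') - A (cpt u t)))
      <= e / 4 * ell * (t' - t).
  move=> us; pose q v := 'i * Phi u v - A (cpt u v).
  rewrite (_ : _ - _ = q t' - q t); last by rewrite /q; ring.
  apply: (@mean_value_bound R q (fun v => 'i * G (cpt u v) - 'i * (b + D * cpt u v))).
  - lra.
  - move=> v vt; apply: path_deriveB.
      by apply: path_deriveZ; apply: hPhi; lra.
    by apply: affine_primitive => // h; exact: cpt_shiftr.
  - move=> v vt; rewrite -mulrBr nrmM nrm_i mul1r; exact: rest.
have tt : t <= t <= t' by lra.
have tt' : t <= t' <= t' by lra.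
have ss : s <= s <= s' by lra.
have ss' : s <= s' <= s' by lra.
pose hb v := (Psi v s' - Psi v s) - (A (cpt s' v) - A (cpt s v)).
pose vb u := 'i * (Phi u t' - Phi u t) - (A (cpt u t') - A (cpt u t)).
have -> : mu s s' t t' = hb t + vb s' - (hb t' + vb s).
  by rewrite /mu /hb /vb; ring.
have := nrmB (hb t + vb s') (hb t' + vb s).
have := nrmD (hb t) (vb s'); have := nrmD (hb t') (vb s).
have := hor _ tt; have := hor _ tt'; have := ver _ ss; have := ver _ ss'.
rewrite -/(hb t) -/(hb t') -/(vb s) -/(vb s') -/ell => b1 b2 b3 b4 b5 b6 b7.
have : e / 4 * ell * (s' - s) + e / 4 * ell * (t' - t) = e / 4 * ell ^+ 2.
  by rewrite -mulrDr -/ell expr2 mulrA.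
have : 0 <= e * ell ^+ 2 by rewrite mulr_ge0 ?(ltW e0) ?sqr_ge0.
by lra.
Qed.

End Goursat.

(** * The complex exponential and integrals over circles *)

Section ComplexExponential.
Local Open Scope complex_scope.
Variable R : realType.
Local Notation C := R[i].

Definition cis (t : R) : C := cos t +i* sin t.

Lemma cisD s t : cis (s + t) = cis s * cis t.
Proof.
apply/eqP; rewrite eq_complex /= cosD sinD eqxx/= addrC; apply/eqP; ring.
Qed.

Lemma cis0 : cis 0 = 1.
Proof. by rewrite /cis cos0 sin0. Qed.

Lemma cisD2pi t : cis (t + pi *+ 2) = cis t.
Proof. by rewrite /cis cosD2pi sinD2pi. Qed.

Lemma nrm_cis t : nrm (cis t) = 1.
Proof.
apply/eqP; rewrite -(@eqrXn2 _ 2) ?nrm_ge0// nrm_sqr expr1n /=.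
by rewrite cos2Dsin2.
Qed.

Lemma continuous_cis : continuous (cis : R -> C^o).
Proof.
by move=> t; apply: cvg_complex; [exact: continuous_cos|exact: continuous_sin].
Qed.

Lemma path_derive_cis0 : path_derive cis 0 'i.
Proof.
have := path_derive_complex (is_derive_cos (0 : R)) (is_derive_sin (0 : R)).
by rewrite sin0 oppr0 cos0.
Qed.

Definition cexp (w : C) : C := (expR (complex.Re w))%:C * cis (complex.Im w).

Lemma cexpD w w' : cexp (w + w') = cexp w * cexp w'.
Proof. by rewrite /cexp !raddfD /= expRD cisD rmorphM mulrACA. Qed.

Lemma cexp0 : cexp 0 = 1.
Proof. by rewrite /cexp /= expR0 cis0 mulr1. Qed.

(** By cexp (w + h) = cexp w * cexp h only the expansion at 0 matters, where
    expR a * cis b - 1 is split along expR a - 1 and cis b - 1. *)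
Lemma cexp_derive w : complex_derive cexp w (cexp w).
Proof.
suff H : complex_derive cexp 0 1.
  move=> e e0; have n0 : 0 < nrm (cexp w) + 1 by have := nrm_ge0 (cexp w); lra.
  have [|del del0 {}H] := H (e / (nrm (cexp w) + 1)); first by rewrite divr_gt0.
  exists del => // h /H; rewrite add0r cexp0 mul1r => h1.
  rewrite cexpD (_ : _ - _ - _ = cexp w * (cexp h - 1 - h)); last by ring.
  rewrite nrmM; have : (nrm (cexp w) + 1) * nrm (cexp h - 1 - h) <= e * nrm h.
    by rewrite -ler_pdivlMl// mulrA [_^-1 * _]mulrC.
  by have := nrm_ge0 (cexp h - 1 - h); nra.
move=> e e0; have e40 : 0 < e / 4 by lra.
have expd := (real_derive_eps _ _ _).1 (is_derive_expR (0 : R)).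
rewrite expR0 in expd.
have [d1 d10 H1] := expd _ e40; have [d2 d20 H2] := expd _ ltr01.
have [d3 d30 H3] := path_derive_cis0 e40.
have [d4 d40 H4] := path_derive_cis0 ltr01.
exists (Num.min (Num.min d1 d2) (Num.min (Num.min d3 d4) (e / 8))).
  by rewrite !lt_min d10 d20 d30 d40 divr_gt0.
move=> h; rewrite !lt_min => /andP[/andP[h1 h2] /andP[/andP[h3 h4] h5]].
have := Re_le_nrm h; have := Im_le_nrm h.
rewrite add0r cexp0 mul1r /cexp.
case: h h1 h2 h3 h4 h5 => a b /=; set n := nrm _ => h1 h2 h3 h4 h5 hb ha.
have := H1 a (le_lt_trans ha h1); have := H2 a (le_lt_trans ha h2).
have := H3 b (le_lt_trans hb h3); have := H4 b (le_lt_trans hb h4).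
rewrite !add0r cis0 !mulr1 !mul1r => g4 g3 g2 g1.
rewrite (_ : _ - _ - _ = ((expR a)%:C - 1) * (cis b - 1) +
   ((expR a - 1 - a)%:C + (cis b - 1 - b%:C * 'i))); last first.
  have -> : a +i* b = a%:C + b%:C * 'i :> C.
    by apply/eqP; rewrite eq_complex /=; apply/andP; split; apply/eqP; ring.
  by rewrite !rmorphB /=; ring.
have a0 := normr_ge0 a; have b0 := normr_ge0 b.
rewrite (le_trans (nrmD _ _))// nrmM.
have := nrmD (expR a - 1 - a)%:C (cis b - 1 - b%:C * 'i).
rewrite nrm_real => k1.
have k2 : nrm ((expR a)%:C - 1) <= 2 * n.
  have := nrmD (expR a - 1 - a)%:C (a%:C).
  rewrite !nrm_real -rmorphD subrK rmorphB; lra.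
have k3 : nrm (cis b - 1) <= 2 * n.
  have := nrmD (cis b - 1 - b%:C * 'i) (b%:C * 'i).
  by rewrite subrK nrmM nrm_i mulr1 nrm_real; lra.
have n0 : 0 <= n by exact: nrm_ge0.
have := ler_pM (nrm_ge0 _) (nrm_ge0 _) k2 k3.
by nra.
Qed.

End ComplexExponential.

Section CircleIntegrals.
Local Open Scope complex_scope.
Variable R : realType.
Local Notation C := R[i].
Local Notation T := (pi *+ 2 : R).
Implicit Types F : R -> C^o.

Let T_gt0 : 0 < T.
Proof. by have := pi_gt0 R; lra. Qed.

(** Integrals over one period [0, 2 pi] are increments of a primitive, which
    exists for continuous functions and is unique up to a constant. *)
Definition has_cint (F : R -> C) (v : C) := exists2 p,
  forall t, 0 <= t <= T -> path_derive p t (F t) & v = p T - p 0.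

Definition cint (F : R -> C) : C := xget 0 [set v | has_cint F v].

Lemma has_cint_bound F v M : (forall t, 0 <= t <= T -> nrm (F t) <= M) ->
  has_cint F v -> nrm v <= M * T.
Proof.
move=> FM [p hp ->]; have := mean_value_bound (ltW T_gt0) hp FM.
by rewrite subr0.
Qed.

Lemma has_cintD F F' v v' : has_cint F v -> has_cint F' v' ->
  has_cint (fun t => F t + F' t) (v + v').
Proof.
move=> [p hp ->] [q hq ->]; exists (fun t => p t + q t); last by ring.
by move=> t tT; apply: path_deriveD; [exact: hp|exact: hq].
Qed.

Lemma has_cintZ (c : C) F v : has_cint F v -> has_cint (fun t => c * F t) (c * v).
Proof.
move=> [p hp ->]; exists (fun t => c * p t); last by ring.
by move=> t tT; apply: path_deriveZ; exact: hp.
Qed.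

Lemma has_cint_cst (c : C) : has_cint (fun=> c) (c * T%:C).
Proof.
exists (fun t => c * t%:C); last by rewrite mulr0 subr0.
move=> t _; rewrite -[X in path_derive _ _ X]mulr1; apply: path_deriveZ.
exact: (path_derive_complex (is_derive_id _ _) (is_derive_cst _ _ _)).
Qed.

Lemma has_cint_uniq F v v' : has_cint F v -> has_cint F v' -> v = v'.
Proof.
move=> hv /(has_cintZ (-1)) hv'; have h := has_cintD hv hv'.
apply/eqP; rewrite -subr_eq0 -nrm_eq0 eq_le nrm_ge0 andbT -[leRHS](mul0r T).
have := has_cint_bound _ h; rewrite mulN1r; apply => t _.
by rewrite mulN1r subrr nrm0.
Qed.

Lemma cintE F v : has_cint F v -> cint F = v.
Proof.
move=> h; apply: (has_cint_uniq (F := F)) (h).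
exact: (@xgetPex _ 0 [set v | has_cint F v] (ex_intro _ v h)).
Qed.

Lemma cintP F : continuous F -> has_cint F (cint F).
Proof.
move=> cF; have [|||p hp] := @primitive_exists R F (-1) (T + 1) _ 0 T.
- by move=> x _; exact: cF.
- by lra.
- by lra.
have h : has_cint F (p T - p 0) by exists p.
by rewrite (cintE h).
Qed.

Lemma has_cint_sum n (F : nat -> R -> C) (v : nat -> C) :
  (forall i, has_cint (F i) (v i)) ->
  has_cint (fun t => \sum_(i < n) F i t) (\sum_(i < n) v i).
Proof.
move=> h; elim: n => [|n IH].
  under eq_fun do rewrite big_ord0; rewrite big_ord0.
  by have := has_cint_cst 0; rewrite mul0r.
under eq_fun do rewrite big_ord_recr /=; rewrite big_ord_recr /=.
exact: has_cintD.
Qed.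

Lemma cint_bounded F : continuous F -> exists M, forall t, 0 <= t <= T -> nrm (F t) <= M.
Proof.
move=> cF; have [|t _ tmax] := @EVT_max R (fun t => nrm (F t)) 0 T (ltW T_gt0).
  by apply: continuous_subspaceT => t; apply: cvg_nrm; exact: cF.
by exists (nrm (F t)) => x xT; apply: tmax; rewrite in_itv.
Qed.

Definition circle (r t : R) : C := r%:C * cis t.

Lemma nrm_circle r t : nrm (circle r t) = `|r|.
Proof. by rewrite nrmM nrm_cis mulr1 nrm_real. Qed.

Lemma circleD2pi r t : circle r (t + T) = circle r t.
Proof. by rewrite /circle cisD2pi. Qed.

Lemma continuous_circle r : continuous (circle r : R -> C^o).
Proof. by move=> t; apply: cvgMl_tmp; exact: continuous_cis. Qed.

End CircleIntegrals.

(** * Means of holomorphic functions over circles *)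

Section CircleMeans.
Local Open Scope complex_scope.
Variable R : realType.
Local Notation C := R[i].
Local Notation T := (pi *+ 2 : R).
Implicit Types H : C -> C.

Let T_gt0 : 0 < T.
Proof. by have := pi_gt0 R; lra. Qed.

Let annulus_le H a b r r' : 0 <= a -> a < r -> r <= r' -> r' < b ->
  (forall w, a < nrm w < b -> exists D, complex_derive H w D) ->
  cint (fun t => H (circle r t)) = cint (fun t => H (circle r' t)).
Proof.
move=> a0 ar rr' r'b hH.
have r0 : 0 < r by lra.
have r'0 : 0 < r' by lra.
have m0 : 0 < (a + r) / 2 by lra.
have M0 : 0 < (r' + b) / 2 by lra.
pose G w := H (cexp w).
have lnc : ln ((a + r) / 2) < ln r by rewrite ltr_ln ?posrE//; lra.
have lnd : ln r' < ln ((r' + b) / 2) by rewrite ltr_ln ?posrE//; lra.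
have lncd : ln r <= ln r' by rewrite ler_ln ?posrE.
have cE s t : cexp (cpt s t) = circle (expR s) t by [].
have [|Phi [Psi [hPhi hPsi E]]] :=
    goursat (G := G) (T := T) lncd (ltW T_gt0) lnc lnd.
  move=> s t /andP[s1 s2]; have [|D hD] := hH (cexp (cpt s t)).
    rewrite cE nrm_circle gtr0_norm ?expR_gt0//.
    rewrite -ltr_expR lnK ?posrE// in s1; rewrite -ltr_expR lnK ?posrE// in s2.
    by apply/andP; split; lra.
  exists (D * cexp (cpt s t)); apply: complex_derive_comp hD.
  exact: cexp_derive.
have Psi0T : (Psi 0 (ln r') - Psi 0 (ln r)) - (Psi T (ln r') - Psi T (ln r)) = 0.
  apply/eqP; rewrite -nrm_eq0 eq_le nrm_ge0 andbT.
  rewrite -[leRHS](mul0r (ln r' - ln r)).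
  rewrite (_ : _ - _ - _ = (Psi 0 (ln r') - Psi T (ln r')) -
    (Psi 0 (ln r) - Psi T (ln r))); last by ring.
  apply: (mean_value_bound (p := fun s => Psi 0 s - Psi T s)
    (F := fun s => G (cpt s 0) - G (cpt s T))) => // s scd.
    by apply: path_deriveB; exact: hPsi.
  have -> : G (cpt s T) = G (cpt s 0).
    by rewrite /G !cE -[circle _ 0]circleD2pi add0r.
  by rewrite subrr nrm0.
have Ei : 'i * (Phi (ln r) T - Phi (ln r) 0) = 'i * (Phi (ln r') T - Phi (ln r') 0).
  apply/eqP; rewrite -subr_eq0 -Psi0T; apply/eqP.
  by move/eqP : E; rewrite -subr_eq0 => /eqP E; rewrite -[LHS]addr0 -{1}E; ring.
have i0 : 'i != 0 :> C by rewrite -nrm_eq0 nrm_i oner_eq0.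
move/(mulfI i0) : Ei => Ei.
transitivity (Phi (ln r) T - Phi (ln r) 0).
  apply: cintE; exists (Phi (ln r)) => // t tT.
  have := hPhi (ln r) t _ tT; rewrite /G cE lnK ?posrE//; apply.
  by rewrite lexx.
rewrite Ei; symmetry; apply: cintE; exists (Phi (ln r')) => // t tT.
have := hPhi (ln r') t _ tT; rewrite /G cE lnK ?posrE//; apply.
by rewrite lexx andbT.
Qed.

(** The exponential turns the annulus into a vertical strip; by periodicity the
    two horizontal sides of a full rectangle of height 2 pi cancel. *)
Lemma circle_mean_const H a b r r' : 0 <= a -> a < r < b -> a < r' < b ->
  (forall w, a < nrm w < b -> exists D, complex_derive H w D) ->
  cint (fun t => H (circle r t)) = cint (fun t => H (circle r' t)).
Proof.
move=> a0 /andP[ar rb] /andP[ar' r'b] hH.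
have [rr'|r'r] := leP r r'; first exact: (annulus_le (b := b) a0 ar rr' r'b hH).
by symmetry; apply: (annulus_le (b := b) a0 ar' (ltW r'r) rb hH).
Qed.

Lemma continuous_comp_circle H r : (forall t, {for circle r t, continuous (H : C^o -> C^o)}) ->
  continuous (fun t => H (circle r t) : C^o).
Proof.
move=> cH t; apply: (continuous_comp (f := circle r : R -> C^o)); last exact: cH.
exact: continuous_circle.
Qed.

(** The integrand is continuous jointly in r and t, hence continuous in r
    uniformly over the compact period. *)
Lemma continuous_circle_mean H rho :
  (forall w, nrm w < rho -> {for w, continuous (H : C^o -> C^o)}) ->
  forall r0, `|r0| < rho ->
    {for r0, continuous (fun r => cint (fun t => H (circle r t)) : C^o)}.
Proof.
move=> cH r0 r0rho.
have cHr r : `|r| < rho -> continuous (fun t => H (circle r t) : C^o).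
  by move=> rrho; apply: continuous_comp_circle => t; apply: cH; rewrite nrm_circle.
apply/(cvg_nrmP (F := nbhs r0)) => e e0.
pose eps := e / (2 * T).
have eps0 : 0 < eps by rewrite divr_gt0// mulr_gt0.
have /compact_near_coveringP cov := @segment_compact R 0 T.
have near_r : \forall r \near r0, `|r| < rho.
  have := @norm_continuous R R^o r0; move=> /cvgr_lt; exact.
have : \forall r \near r0, `[0, T]%classic `<=`
    (fun t => nrm (H (circle r0 t) - H (circle r t)) <= eps).
  apply: (cov R (nbhs r0) (fun r t => nrm (H (circle r0 t) - H (circle r t)) <= eps)).
  move=> t _.
  have e20 : 0 < eps / 2 by lra.
  have joint : (fun p : R * R => H (circle p.2 p.1) : C^o) @ (t, r0) -->
      (H (circle r0 t) : C^o).
    have cH0 : {for circle r0 t, continuous (H : C^o -> C^o)}.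
      by apply: cH; rewrite nrm_circle.
    have c1 : (fun p : R * R => p.2%:C : C^o) @ (t, r0) --> (r0%:C : C^o).
      by apply: cvg_complex; [exact: cvg_snd|exact: cvg_cst].
    have c2 : (fun p : R * R => cis p.1 : C^o) @ (t, r0) --> (cis t : C^o).
      by apply: (cvg_comp _ _ cvg_fst); exact: continuous_cis.
    exact: (cvg_comp _ _ (cvgM c1 c2) cH0).
  have h1 := (@cvg_nrmP R _ (nbhs (t, r0)) (nbhs_filter (t, r0)) _ _).1 joint _ e20.
  have h2 := (@cvg_nrmP R _ (nbhs t) (nbhs_filter t) _ _).1 (cHr _ r0rho t) _ e20.
  have h2' := @cvg_fst _ _ (nbhs t) (nbhs r0) (nbhs_filter r0) _ h2.
  apply: filterS2 h1 h2' => -[t' r] /= g1 g2.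
  have := nrm_triangle (H (circle r0 t)) (H (circle r0 t')) (H (circle r t')).
  by rewrite [nrm (H (circle r0 t') - H (circle r0 t))]nrm_distC; lra.
apply: filterS2 near_r => r rrho Hr.
have [p hp pE] := cintP (cHr _ r0rho); have [q hq qE] := cintP (cHr _ rrho).
rewrite pE qE (_ : _ - _ - _ = (p T - q T) - (p 0 - q 0)); last by ring.
apply: (@le_lt_trans _ _ (eps * (T - 0))).
  apply: (mean_value_bound (p := fun t => p t - q t)
    (F := fun t => H (circle r0 t) - H (circle r t)) (ltW T_gt0)) => t tT.
    by apply: path_deriveB; [exact: hp|exact: hq].
  by apply: Hr; rewrite /= in_itv.
rewrite subr0 /eps invfM mulrA -mulrA mulVf ?gt_eqF// mulr1; lra.
Qed.

Let endpoint_value (J : R -> C^o) a b k : a < b ->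
  (forall r, a < r < b -> J r = k) ->
  ({for a, continuous J} -> J a = k) /\ ({for b, continuous J} -> J b = k).
Proof.
move=> ab Jk; split=> cJ.
  have h : J r @[r --> a^'+] --> J a by apply: cvg_at_right_filter.
  suff c : J r @[r --> a^'+] --> k by exact: (cvg_unique (@norm_hausdorff _ _) h c).
  apply: cvg_near_cst; near=> r; apply: Jk.
  by apply/andP; split; near: r; [exact: nbhs_right_gt|exact: nbhs_right_lt].
have h : J r @[r --> b^'-] --> J b by apply: cvg_at_left_filter.
suff c : J r @[r --> b^'-] --> k by exact: (cvg_unique (@norm_hausdorff _ _) h c).
apply: cvg_near_cst; near=> r; apply: Jk.
by apply/andP; split; near: r; [exact: nbhs_left_gt|exact: nbhs_left_lt].
Unshelve. all: by end_near. Qed.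

(** The mean is constant for radii below |z| and above |z|, and it is continuous
    in the radius, so that it keeps the value 0 which it has for radius 0. *)
Lemma circle_mean_eq0 H z rho r : 0 <= r < rho -> nrm z < rho -> H 0 = 0 ->
  (forall w, nrm w < rho -> {for w, continuous (H : C^o -> C^o)}) ->
  (forall w, nrm w < rho -> w != z -> exists D, complex_derive H w D) ->
  cint (fun t => H (circle r t)) = 0.
Proof.
move=> /andP[r0 rrho] zrho H0 cH hH; have z0 := nrm_ge0 z.
pose J r : C^o := cint (fun t => H (circle r t)).
rewrite -/(J r).
have J0 : J 0 = 0.
  apply: cintE; have := has_cint_cst (0 : C); rewrite mul0r.
  by congr has_cint; apply/funext => t; rewrite /circle mul0r H0.
have cJ s : 0 <= s -> s < rho -> {for s, continuous J}.
  by move=> s0 srho; apply: continuous_circle_mean cH _ _; rewrite ger0_norm.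
have dH a b w : (a = nrm z /\ b = rho) \/ (a = 0 /\ b = nrm z) ->
    a < nrm w < b -> exists D, complex_derive H w D.
  move=> ab wab; apply: hH.
    by case: ab => -[E1 E2]; rewrite E1 E2 in wab; lra.
  apply/eqP => wz; rewrite wz in wab.
  by case: ab => -[E1 E2]; rewrite E1 E2 in wab; lra.
have Jz : forall s, 0 <= s <= nrm z -> J s = 0.
  have [zz|z1] := leP (nrm z) 0; first by move=> s s0; have -> : s = 0 by lra.
  have k s : 0 < s < nrm z -> J s = J (nrm z / 2).
    move=> sz; apply: (circle_mean_const (a := 0) (b := nrm z)) => //; first lra.
    by move=> w; apply: dH; right.
  have [k0 k1] := endpoint_value z1 k.
  have Jm : J (nrm z / 2) = 0 by rewrite -J0; symmetry; apply: k0; apply: cJ => //; lra.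
  move=> s /andP[]; rewrite le_eqVlt => /predU1P[<-//|s0].
  rewrite le_eqVlt => /predU1P[->|s1]; first by rewrite (k1 (cJ _ z0 zrho)).
  by rewrite k ?s0.
have [rz|zr] := leP r (nrm z); first by rewrite Jz// r0.
pose m := (nrm z + rho) / 2.
have k s : nrm z < s < rho -> J s = J m.
  move=> sz; apply: (circle_mean_const (a := nrm z) (b := rho)) => //.
    by rewrite /m; lra.
  by move=> w; apply: dH; left.
have [k0 _] := endpoint_value zrho k.
rewrite k ?zr// -(k0 (cJ _ z0 zrho)).
by apply: Jz; rewrite z0 lexx.
Qed.

End CircleMeans.

(** * Taylor expansion *)

Section Taylor.
Local Open Scope complex_scope.
Variable R : realType.
Local Notation C := R[i].
Local Notation T := (pi *+ 2 : R).

Let T_gt0 : 0 < T.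
Proof. by have := pi_gt0 R; lra. Qed.

Lemma complex_derive_near (G H : C -> C) w d (del : R) : 0 < del ->
  (forall h, nrm h < del -> G (w + h) = H (w + h)) ->
  complex_derive H w d -> complex_derive G w d.
Proof.
move=> del0 GH hH e e0; have [del' del'0 H'] := hH e e0.
exists (Num.min del del'); first by rewrite lt_min del0.
move=> h; rewrite lt_min => /andP[h1 h2].
by rewrite GH// -[w in G w]addr0 GH ?nrm0// addr0 H'.
Qed.

(** The factor w turns the integral of the difference quotient against dw into
    a mean over the circle, where dw = i w dt. *)
Definition difference_quotient (g : C -> C) (z d w : C) : C :=
  if w == z then d * z else (g w - g z) / (w - z) * w.

Section DifferenceQuotient.
Variables (g : C^o -> C^o) (rho : R) (z d : C).
Hypothesis g_derivable : forall w, nrm w < rho -> derivable g w 1.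
Hypothesis zrho : nrm z < rho.
Hypothesis g_derive_z : complex_derive g z d.

Lemma difference_quotient_derive w : nrm w < rho -> w != z ->
  exists D, complex_derive (difference_quotient g z d) w D.
Proof.
move=> wrho wz; have wz0 : w - z != 0 by rewrite subr_eq0.
pose q (x : C^o) : C^o := (g x - g z) * (x - z)^-1 * x.
have [|D hD] := @derivable_complex_derive R q w.
  apply: derivableM => //; apply: derivableM.
    by apply: derivableB => //; exact: g_derivable.
  by apply: derivableV => //; apply: derivableB.
exists D; apply: (complex_derive_near (del := nrm (w - z))) hD; first by rewrite nrm_gt0.
move=> h hwz; rewrite /difference_quotient; case: eqVneq => // E.
by move: hwz; rewrite -E opprD addrA subrr sub0r nrmN ltxx.
Qed.

Lemma difference_quotient_continuous w : nrm w < rho ->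
  {for w, continuous (difference_quotient g z d : C^o -> C^o)}.
Proof.
move=> wrho; have [->|wz] := eqVneq w z; last first.
  by have [D] := difference_quotient_derive wrho wz; exact: complex_derive_continuous.
apply/(cvg_nrmP (F := nbhs (z : C^o))) => e e0.
have z0 := nrm_ge0 z; have d0 := nrm_ge0 d.
pose e1 := e / (2 * (nrm z + 1)).
have e10 : 0 < e1 by rewrite divr_gt0// mulr_gt0//; lra.
have [del del0 H] := g_derive_z e10.
pose m := Num.min (Num.min del 1) (e / (2 * (nrm d + 1))).
have m0 : 0 < m by rewrite !lt_min del0 ltr01 divr_gt0// mulr_gt0//; lra.
near=> y; pose h : C := y - z.
have hm : nrm h < m.
  have : ball (z : C^o) m%:C y by near: y; apply: nbhsx_ballx; rewrite ltcR.
  by rewrite -ball_normE /= distrC nrmE ltcR.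
move: hm; rewrite !lt_min => /andP[/andP[hdel h1] hd].
rewrite {1}/difference_quotient eqxx /difference_quotient.
case: eqVneq => [_|yz]; first by rewrite subrr nrm0.
have h0 : h != 0 by rewrite subr_eq0.
have yE : y = z + h by rewrite /h addrC subrK.
have := H h hdel; rewrite -yE -ler_pdivrMr ?nrm_gt0// -nrmV -nrmM => Hh.
rewrite nrm_distC (_ : _ - _ = (g y - g z - d * h) * h^-1 * (z + h) + d * h); last first.
  by rewrite -/h yE; field.
rewrite (le_lt_trans (nrmD _ _))// !nrmM -nrmM.
have zh : nrm (z + h) <= nrm z + 1 by rewrite (le_trans (nrmD _ _))//; lra.
have := ler_pM (nrm_ge0 _) (nrm_ge0 _) Hh zh.
have -> : e1 * (nrm z + 1) = e / 2 by rewrite /e1; field; rewrite gt_eqF//; lra.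
have : (nrm d + 1) * nrm h < e / 2.
  rewrite -ltr_pdivlMl; last lra.
  rewrite (_ : _^-1 * (e / 2) = e / (2 * (nrm d + 1)))//.
  by field; rewrite gt_eqF//; lra.
by have := nrm_ge0 h; nra.
Unshelve. all: by end_near. Qed.

End DifferenceQuotient.

Let circle_neq0 r t : 0 < r -> circle r t != 0 :> C.
Proof. by move=> r0; rewrite -nrm_gt0 nrm_circle gtr0_norm. Qed.

Let continuous_circleV r n : 0 < r ->
  continuous (fun t => (circle r t)^-1 ^+ n : C^o).
Proof.
move=> r0 t; elim: n => [|n IH]; first exact: cvg_cst.
rewrite (_ : (fun _ => _) = fun t => (circle r t)^-1 * (circle r t)^-1 ^+ n :> C^o).
  have h : (fun s => (circle r s)^-1 : C^o) @ t --> ((circle r t)^-1 : C^o).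
    by apply: cvgV; [exact: circle_neq0|exact: continuous_circle].
  exact: (cvgM h IH).
by apply/funext => s; rewrite exprS.
Qed.

(** By homogeneity the mean of the n-th inverse power over the circle of radius
    2 is 2^-n times its mean over the unit circle; the two are equal. *)
Lemma circle_mean_negative_power r n : 0 < r -> (0 < n)%N ->
  has_cint (fun t => (circle r t)^-1 ^+ n) (0 : C).
Proof.
move=> r0 n0.
have dpow (w : C) : w != 0 -> exists D, complex_derive (fun w => w^-1 ^+ n) w D.
  move=> w0; apply: (@derivable_complex_derive R (fun w : C^o => (w^-1 : C^o) ^+ n : C^o)).
  have dV : derivable (fun w : C^o => w^-1 : C^o) w 1 by apply: derivableV.
  rewrite (_ : (fun _ => _) = ((fun w : C^o => w^-1 : C^o) : C^o -> C^o) ^+ n).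
    exact: derivableX.
  by apply/funext => x; elim: (n) => [|k IH]; rewrite ?expr0// !exprS IH.
have mean s s' : 0 < s -> 0 < s' ->
    cint (fun t => (circle s t)^-1 ^+ n) = cint (fun t => (circle s' t)^-1 ^+ n) :> C.
  move=> s0 s'0; apply: (circle_mean_const (a := 0) (b := s + s' + 1)
    (H := fun w : C => w^-1 ^+ n)) => //; [lra|lra|].
  by move=> w /andP[w0 _]; apply: dpow; rewrite -nrm_gt0.
have H1 := cintP (@continuous_circleV _ n ltr01).
have H2 := cintP (@continuous_circleV _ n (ltr0Sn R 1)).
have := has_cintZ ((2^-1)%:C ^+ n) H1.
have -> : (fun t => (2^-1)%:C ^+ n * (circle 1 t)^-1 ^+ n) =
    (fun t => (circle 2 t)^-1 ^+ n) :> (R -> C).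
  apply/funext => t; rewrite -exprMn; congr (_ ^+ _).
  by rewrite /circle mul1r invfM fmorphV.
move=> /has_cint_uniq/(_ H2); rewrite (mean 2 1)// => E.
have := cintP (@continuous_circleV _ n r0); rewrite (mean r 1)//.
set v := cint _ in E *; suff -> : v = 0 by [].
apply/eqP; rewrite -nrm_eq0 eq_le nrm_ge0 andbT.
have := congr1 (@nrm R _) E; rewrite nrmM nrmX nrm_real ger0_norm ?invr_ge0// => E'.
have : 2^-1 ^+ n <= 2^-1 :> R.
  by rewrite -{2}[2^-1]expr1 ler_wiXn2l// ?invr_ge0// invf_le1//; lra.
by have := nrm_ge0 v; nra.
Qed.

Let geometric_split (q u : C) N : q = 1 + u * q ->
  q = \sum_(n < N) u ^+ n + u ^+ N * q.
Proof.
move=> qE; elim: N => [|N IH]; first by rewrite big_ord0 add0r expr0 mul1r.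
by rewrite {1}IH big_ord_recr /= -addrA {1}qE exprSr; ring.
Qed.

(** Cauchy's formula in the form of a power series: the mean of the difference
    quotient vanishes, and its kernel expands geometrically. *)
Theorem taylor_expansion (g : C^o -> C^o) (rho : R) : 1 < rho ->
  (forall w, nrm w < rho -> derivable g w 1) ->
  exists (c : nat -> C) (K t : R),
    [/\ 0 <= t < 1, forall n, nrm (c n) <= K * t ^+ n &
        forall z, nrm z < 1 -> power_sum c z (g z)].
Proof.
move=> rho1 dg; pose r := (1 + rho) / 2.
have r1 : 1 < r by rewrite /r; lra.
have rrho : r < rho by rewrite /r; lra.
have r0 : 0 < r by lra.
have TC0 : T%:C != 0 :> C by rewrite (inj_eq (@complexI R) _ 0) gt_eqF.
have cg : continuous (fun t => g (circle r t) : C^o).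
  apply: continuous_comp_circle => t.
  have [|D hD] := @derivable_complex_derive R g (circle r t).
    by apply: dg; rewrite nrm_circle gtr0_norm.
  exact: complex_derive_continuous hD.
have cgV n : continuous (fun t => (circle r t)^-1 ^+ n * g (circle r t) : C^o).
  by move=> t; exact: (cvgM (@continuous_circleV _ n r0 t) (cg t)).
pose a n := cint (fun t => (circle r t)^-1 ^+ n * g (circle r t)).
pose c n := T%:C^-1 * a n.
have nrmT : nrm (T%:C : C) = T by rewrite nrm_real gtr0_norm.
have nV n t : nrm ((circle r t : C)^-1 ^+ n) = r^-1 ^+ n.
  by rewrite nrmX nrmV nrm_circle gtr0_norm.
have [M HM] := cint_bounded cg.
have rV : 0 <= r^-1 < 1 by rewrite invr_ge0 (ltW r0) invf_lt1.
exists c, M, r^-1; split => // [n|z z1].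
  rewrite nrmM nrmV nrmT ler_pdivrMl// [leRHS]mulrC.
  apply: has_cint_bound (cintP (cgV n)) => t tT.
  by rewrite nrmM nV mulrC ler_wpM2r ?exprn_ge0 ?HM//; case/andP: rV.
have zrho : nrm z < rho by lra.
have [d hd] := derivable_complex_derive (dg z zrho).
pose H := difference_quotient g z d.
have HC w : nrm w < rho -> {for w, continuous (H : C^o -> C^o)}.
  exact: difference_quotient_continuous.
have cH : continuous (fun t => H (circle r t) : C^o).
  by apply: continuous_comp_circle => t; apply: HC; rewrite nrm_circle gtr0_norm.
have H0 : cint (fun t => H (circle r t)) = 0.
  apply: (circle_mean_eq0 (z := z) (rho := rho)) => //.
  - by rewrite (ltW r0).
  - by rewrite /H /difference_quotient; case: eqVneq => [<-|_]; rewrite mulr0.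
  - exact: difference_quotient_derive.
have [M' HM'] := cint_bounded cH.
pose V N := cint (fun t => (circle r t)^-1 ^+ N * H (circle r t)).
have cHV N : continuous (fun t => (circle r t)^-1 ^+ N * H (circle r t) : C^o).
  by move=> t; exact: (cvgM (@continuous_circleV _ N r0 t) (cH t)).
(* The expansion of w / (w - z) to order N; its remainder is (z / w) ^ N times
   the same quotient. *)
have split_H N t : H (circle r t) =
    \sum_(n < N) z ^+ n * ((circle r t)^-1 ^+ n * g (circle r t) +
      - g z * (circle r t)^-1 ^+ n) + z ^+ N * ((circle r t)^-1 ^+ N * H (circle r t)).
  have w0 := circle_neq0 t r0; set w := circle r t in w0 *.
  have wz : w != z.
    by apply/eqP => E; move: z1; rewrite -E nrm_circle gtr0_norm//; lra.
  have wz0 : w - z != 0 by rewrite subr_eq0.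
  have HE : H w = (g w - g z) * (w / (w - z)).
    by rewrite /H /difference_quotient (negPf wz) mulrAC -mulrA.
  have q1 : w / (w - z) = 1 + z / w * (w / (w - z)) by field; rewrite w0 wz0.
  rewrite {1}HE (geometric_split N q1) mulrDr mulr_sumr; congr (_ + _).
    by apply: eq_bigr => n _; rewrite exprMn; ring.
  by rewrite exprMn HE; ring.
(* The mean over the circle keeps g z from the term n = 0 only. *)
have key N : (0 < N)%N -> T%:C * (\sum_(n < N) c n * z ^+ n - g z) = - (z ^+ N * V N).
  case: N => // N _.
  have cst0 : has_cint (fun t => (circle r t)^-1 ^+ 0 : C) T%:C.
    by under eq_fun do rewrite expr0; have := has_cint_cst (1 : C); rewrite mul1r.
  have power n : has_cint (fun t => (circle r t)^-1 ^+ n : C) (if n == 0%N then T%:C else 0).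
    by case: n => [//|n]; exact: circle_mean_negative_power.
  have term n : has_cint (fun t => z ^+ n * ((circle r t)^-1 ^+ n * g (circle r t) +
      - g z * (circle r t)^-1 ^+ n)) (z ^+ n * (a n + - g z * (if n == 0%N then T%:C else 0))).
    exact: has_cintZ (has_cintD (cintP (cgV n)) (has_cintZ (- g z) (power n))).
  have := has_cintD (has_cint_sum N.+1 term) (has_cintZ (z ^+ N.+1) (cintP (cHV N.+1))).
  under eq_fun do rewrite -split_H.
  move=> /has_cint_uniq/(_ (cintP cH)); rewrite H0 -/(V N.+1) => /eqP.
  rewrite addr_eq0 => /eqP <-.
  rewrite !big_ord_recl /= mulrBr mulrDr addrAC; congr (_ + _).
    by rewrite /c !expr0 mulr1 mulrA mulfV// !mul1r; ring.
  rewrite mulr_sumr; apply: eq_bigr => i _.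
  by rewrite /c mulr0 addr0 !mulrA mulfV// mul1r mulrC.
(* The summand nrm (g z) accounts for the empty partial sum. *)
pose B := M' + nrm (g z).
apply: (@cvg0_le _ _ (fun n => B * (nrm z / r) ^+ n)).
- by move=> n; exact: nrm_ge0.
- have M'0 : 0 <= M'.
    by apply: le_trans (HM' 0 _); rewrite ?nrm_ge0// lexx ltW.
  case=> [|N].
    by rewrite big_ord0 sub0r nrmN expr0 mulr1 /B; lra.
  rewrite -(ler_pM2l T_gt0) -{1}nrmT -nrmM key// nrmN nrmM nrmX.
  have VM : nrm (V N.+1) <= r^-1 ^+ N.+1 * M' * T.
    apply: has_cint_bound (cintP (cHV N.+1)) => t tT.
    by rewrite nrmM nV ler_wpM2l ?exprn_ge0 ?HM'//; case/andP: rV.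
  have zN : 0 <= nrm z ^+ N.+1 by rewrite exprn_ge0 ?nrm_ge0.
  rewrite (le_trans (ler_wpM2l zN VM))//.
  rewrite exprMn [leLHS](_ : _ = T * (M' * (nrm z ^+ N.+1 * r^-1 ^+ N.+1))); last by ring.
  rewrite ler_pM2l// ler_wpM2r//; last by rewrite /B; have := nrm_ge0 (g z); lra.
  by rewrite mulr_ge0// exprn_ge0//; case/andP: rV.
- apply: cvg_geo0; rewrite divr_ge0 ?nrm_ge0 ?(ltW r0)//= ltr_pdivrMr//; lra.
Qed.

End Taylor.

(** * The function space *)

Section DiskGeometry.
Local Open Scope complex_scope.
Variable R : realType.
Local Notation C := R[i].

Lemma unit_diskE (z : C^o) : unit_disk z <-> nrm z < 1.
Proof. by rewrite -(ltcR (nrm z) 1) -nrmE. Qed.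

Lemma closure_unit_disk (w : C^o) : nrm w <= 1 -> closure (@unit_disk R) w.
Proof.
move=> w1 B /nbhs_ballP[_ /= /complex_pos[e e0 ->] eB].
pose d := Num.min (e / 2) 2^-1.
have d0 : 0 < d by rewrite lt_min; apply/andP; split; lra.
have d1 : d <= 2^-1 by rewrite ge_min lexx orbT.
have de : d <= e / 2 by rewrite ge_min lexx.
have n0 := nrm_ge0 w.
exists ((1 - d)%:C * w); split.
  apply/unit_diskE; rewrite nrmM nrm_real ger0_norm; last lra.
  by rewrite (@le_lt_trans _ _ (1 - d))// ?ler_piMr//; lra.
apply: eB; rewrite -ball_normE /= nrmE ltcR.
rewrite (_ : w - _ = d%:C * w); last by rewrite rmorphB; ring.
by rewrite nrmM nrm_real gtr0_norm// (@le_lt_trans _ _ d)// ?ler_piMr// ?(ltW d0)//; lra.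
Qed.

(** The closed disk is compact, so every dilation of ratio close enough to 1
    maps it into U. *)
Lemma larger_disk (U : set C^o) : open U -> closure (@unit_disk R) `<=` U ->
  exists2 rho : R, 1 < rho & forall w : C^o, nrm w < rho -> U w.
Proof.
move=> oU DU; pose sq : set (R * R) := `[-1, 1] `*` `[-1, 1].
have /compact_near_coveringP cov : compact sq.
  by apply: compact_setX; exact: segment_compact.
pose P (s : R) (p : R * R) := nrm (p.1 +i* p.2 : C) <= 1 -> U (s%:C * (p.1 +i* p.2)).
have near1 : \forall s \near (1 : R), sq `<=` P s.
  apply: (cov R (nbhs (1 : R)) P) => -[x y] _.
  have pt : (fun q : (R * R) * R => (q.1.1 +i* q.1.2 : C^o)) @ ((x, y), (1 : R)) -->
      (x +i* y : C^o).
    apply: cvg_complex; apply: (cvg_comp _ _ cvg_fst); [exact: cvg_fst|exact: cvg_snd].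
  have [xy1|xy1] := leP (nrm (x +i* y : C)) 1.
    have sc : (fun q : (R * R) * R => (q.2%:C : C^o)) @ ((x, y), (1 : R)) --> (1%:C : C^o).
      by apply: cvg_complex; [exact: cvg_snd|exact: cvg_cst].
    have := cvgM sc pt; rewrite mul1r => L.
    have : nbhs (x +i* y : C^o) U.
      by apply: open_nbhs_nbhs; split => //; apply: DU; exact: closure_unit_disk.
    move=> hU; have hL : nbhs ((x, y), (1 : R))
        [set q : (R * R) * R | U (q.2%:C * (q.1.1 +i* q.1.2))] := L _ _ hU.
    by near=> q => _; near: q; exact: hL.
  have gt1 : nbhs ((x, y), (1 : R)) [set q : (R * R) * R | 1 < nrm (q.1.1 +i* q.1.2 : C)].
    by have L := cvg_nrm pt; exact: (cvgr_gt _ (L _) 1 xy1).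
  near=> q; rewrite /P leNgt => /negP; case; near: q; exact: gt1.
have : \forall s \near (1 : R)^'+, sq `<=` P s by apply: cvg_within.
have gt1 := nbhs_right_gt (1 : R).
move=> H; have [s [s1 Hs]] := filter_ex (filterI gt1 H).
exists s => // w ws; have s0 : 0 < s by lra.
pose v : C := s^-1%:C * w.
have vw : w = s%:C * v by rewrite /v mulrA -rmorphM mulfV ?gt_eqF// mul1r.
have v1 : nrm v <= 1.
  by rewrite nrmM nrm_real gtr0_norm ?invr_gt0// ler_pdivrMl// mulr1 ltW.
have := Hs (complex.Re v, complex.Im v); rewrite /P /=.
have -> : complex.Re v +i* complex.Im v = v by case: (v).
rewrite -vw; apply=> //; split; rewrite /= in_itv/= -ler_norml.
  exact: le_trans (Re_le_nrm v) v1.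
exact: le_trans (Im_le_nrm v) v1.
Unshelve. all: by end_near. Qed.

Lemma compact_disk_bound (A : set (disk R)) : compact A ->
  exists2 r : R, 0 <= r < 1 & forall z, A z -> nrm (\val z : C^o) <= r.
Proof.
move=> cA; have [->|/set0P A0] := eqVneq A set0; first by exists 0 => //; lra.
have [|c cA' cmax] := @compact_EVT_max _ R (fun z : disk R => nrm (\val z : C^o)) A A0 cA.
  apply: continuous_subspaceT => z; apply: (cvg_nrm (F := nbhs z)).
  exact: (@initial_continuous (disk R) C^o (@set_val C^o (@unit_disk R)) z).
exists (nrm (\val c : C^o)).
  by rewrite nrm_ge0/=; apply/unit_diskE; exact: set_mem (valP c).
by move=> z Az; apply: cmax; exact: mem_set.
Qed.

Lemma separable_sequence (Y : normedModType C) : separable_space Y ->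
  exists x : nat -> Y, forall y (e : R), 0 < e -> exists k, nrm (y - x k) < e.
Proof.
move=> [S /countable_injP[f finj] dS].
exists (fun n => xget 0 [set y | S y /\ f y = n]) => y e e0.
have [||z [yz Sz]] := dS (ball y e%:C).
- by exists y; apply: ballxx; rewrite ltcR.
- exact: ball_open.
exists (f z); have [Sx fx] := @xgetPex _ 0 [set y | S y /\ f y = f z]
  (ex_intro _ z (conj Sz erefl)).
rewrite (finj _ _ (mem_set Sx) (mem_set Sz) fx).
by move: yz; rewrite -ball_normE /= nrmE ltcR.
Qed.

End DiskGeometry.

Section Construction.
Local Open Scope complex_scope.
Variable R : realType.
Local Notation C := R[i].
Variables (Y : completeNormedModType C) (alpha : nat -> R).
Hypothesis alpha_gt0 : forall n, 0 < alpha n.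
Hypothesis alpha_root : (alpha n `^ (n%:R^-1)) @[n --> \oo] --> (1 : R).
Variables (e : nat -> Y) (f : nat -> {scalar Y}).
Hypothesis e_unit : forall n, nrm (e n) = 1.
Hypothesis f_e : forall i j, f i (e j) = (i == j)%:R.
Hypothesis f_bound : forall n y, nrm (f n y) <= 4 * n.+2%:R ^+ 3 * nrm y.
Hypothesis f_total : forall y, (forall n, f n y = 0) -> y = 0.

(** Coordinates with respect to the rescaled vectors [monomial n], which are to
    represent z ^ n with norm alpha n. *)
Definition coef (y : Y) n : C := (alpha n)^-1%:C * f n y.
Definition monomial n : Y := (alpha n)%:C *: e n.

Let coef_bound n : R := (alpha n)^-1 * (4 * n.+2%:R ^+ 3).

Let alphaC_neq0 n : (alpha n)%:C != 0 :> C.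
Proof. by rewrite (inj_eq (@complexI R) _ 0) gt_eqF. Qed.

Let coef_bound_ge0 n : 0 <= coef_bound n.
Proof. by rewrite mulr_ge0 ?invr_ge0 ?(ltW (alpha_gt0 n))// mulr_ge0// exprn_ge0. Qed.

Let nrm_coef y n : nrm (coef y n) <= coef_bound n * nrm y.
Proof.
have an := alpha_gt0 n.
rewrite nrmM nrm_real gtr0_norm ?invr_gt0// -mulrA ler_wpM2l// invr_ge0 ltW//.
Qed.

Let subexp_coef_bound : subexponential coef_bound.
Proof.
apply: subexponentialM => [n|n||].
- by rewrite invr_ge0 ltW.
- by rewrite mulr_ge0// exprn_ge0.
- exact: subexponential_root_inv.
apply: subexponentialZ => //; apply: (@subexponential_shift R (fun n => n.+1%:R ^+ 3)).
exact: subexponential_nat_exp.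
Qed.

Let subexp_coef y : subexponential (fun n => nrm (coef y n)).
Proof.
apply: (@subexponential_le _ _ (fun n => nrm y * coef_bound n)).
  by move=> n; rewrite mulrC nrm_coef.
by apply: subexponentialZ => //; exact: nrm_ge0.
Qed.

Let coefD a x y n : coef (a *: x + y) n = a * coef x n + coef y n.
Proof. by rewrite /coef linearP /= mulrDr mulrCA. Qed.

Definition series_fun (y : Y) (z : C^o) : C^o := xget 0 [set s | power_sum (coef y) z s].

Let series_funP y z : nrm z < 1 -> power_sum (coef y) z (series_fun y z).
Proof. by move=> z1; apply: xgetPex; exact: power_sum_exists. Qed.

Lemma series_funE y c z s : (forall n, coef y n = c n) -> nrm z < 1 ->
  power_sum c z s -> series_fun y z = s.
Proof.
move=> /funext yc z1 cs; apply: (sums_to_uniq (series_funP y z1)).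
by rewrite yc.
Qed.

Lemma series_fun_derivable y z : nrm z < 1 -> derivable (series_fun y) z 1.
Proof.
move=> z1; apply: (power_sum_derivable (subexp_coef y)) => // w w1.
exact: series_funP.
Qed.

Definition incl (y : Y) : disk R -> C^o := restrict_disk (series_fun y).

Let disk_lt1 (z : disk R) : nrm (\val z : C^o) < 1.
Proof. by apply/unit_diskE; exact: set_mem (valP z). Qed.

Lemma incl_linear : linear incl.
Proof.
move=> a x y; apply/funext => z; rewrite /incl /restrict_disk.
apply: (sums_to_uniq (series_funP _ (disk_lt1 z))).
have := sums_toD (sums_toZ a (series_funP x (disk_lt1 z))) (series_funP y (disk_lt1 z)).
by congr sums_to; apply/funext => n; rewrite coefD mulrDl mulrA.
Qed.

Lemma incl_Hol y : Hol (incl y).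
Proof. by exists (series_fun y) => // z /unit_diskE; exact: series_fun_derivable. Qed.

Definition inclL : {linear Y -> (disk R -> C^o)} :=
  HB.pack incl (GRing.isLinear.Build C Y (disk R -> C^o) *:%R incl incl_linear).

Lemma incl_inj : injective inclL.
Proof.
move=> x y /eqP; rewrite -subr_eq0 -linearB => /eqP xy0.
apply/eqP; rewrite -subr_eq0; apply/eqP; apply: f_total => n.
have c0 : coef (x - y) n = 0.
  apply: (power_sum_eq0 (subexp_coef (x - y))) => z _ z1.
  have zD : z \in @unit_disk R by apply/mem_set/unit_diskE.
  have E : series_fun (x - y) z = 0 :=
    congr1 (fun F : disk R -> C^o => F (exist _ z zD)) xy0.
  by rewrite -E; exact: series_funP.
move/eqP : c0; rewrite mulf_eq0 fmorphV invr_eq0 (negPf (alphaC_neq0 n)) /=.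
by move/eqP.
Qed.

(** On a smaller disk the inclusion is bounded, the coefficient bounds being
    summable against the powers of the radius. *)
Lemma incl_continuous : continuous (inclL : Y -> {family compact, disk R -> C^o}).
Proof.
move=> y0; apply/fam_cvgP => A /compact_disk_bound[r r01 Ar].
have [K [t [K0 t01 HK]]] := subexponential_geometric coef_bound_ge0 subexp_coef_bound r01.
have bound y z : A z -> nrm (incl y z) <= K / (1 - t) * nrm y.
  move=> Az; rewrite mulrAC.
  apply: (sums_to_bound _ t01 _ (series_funP y (disk_lt1 z))).
    by rewrite mulr_ge0// nrm_ge0.
  move=> n; rewrite nrmM nrmX [leRHS]mulrAC (le_trans _ (ler_wpM2r (nrm_ge0 y) (HK n)))//.
  rewrite [leRHS]mulrAC ler_pM ?nrm_ge0 ?exprn_ge0 ?nrm_ge0 ?nrm_coef//.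
  by apply: lerXn2r; rewrite ?nnegrE ?nrm_ge0 ?Ar//; case/andP: r01.
move=> P /uniform_nbhs[E [entE EP]].
move: entE; rewrite -entourage_ballE => -[_ /= /complex_pos[d d0 ->] dE].
have t1 : 0 < 1 - t by case/andP: t01 => _ t1; lra.
pose M := K / (1 - t) + 1.
have M0 : 0 < M by rewrite /M ltr_wpDl// divr_ge0// ltW.
apply/nbhs_ballP; exists (d / M)%:C; first by rewrite /= ltcR divr_gt0.
move=> y; rewrite -ball_normE /= nrmE ltcR ltr_pdivlMr// mulrC => yM.
apply: EP => z Az; apply: dE; rewrite -ball_normE /= nrmE ltcR.
have -> : incl y0 z - incl y z = incl (y0 - y) z.
  by have := congr1 (fun F => F z) (linearB inclL y0 y).
apply: le_lt_trans (bound _ _ Az) _; apply: le_lt_trans yM.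
by rewrite ler_wpM2r ?nrm_ge0// /M lerDl.
Qed.

Definition hol_space : banach_hol_space R :=
  BanachHolSpace incl_inj incl_Hol incl_continuous.

Lemma nrm_monomial n : nrm (monomial n) = alpha n.
Proof. by rewrite nrmZ e_unit mulr1 nrm_real gtr0_norm. Qed.

(** The functionals f_n are continuous, so they pass through the series. *)
Lemma coef_sums_to (c : nat -> C) y : sums_to (fun n => c n *: monomial n) y ->
  forall n, coef y n = c n.
Proof.
move=> cy n.
have := sums_to_map (phi := f n) (f_bound n) cy.
have := @sums_to_finite R C (fun i => f n (c i *: monomial i)) n.+1.
rewrite big_ord_recr /= big1; last first.
  move=> i _; rewrite !linearZ /= f_e (_ : (n == i) = false) ?mulr0//.
  by rewrite gtn_eqF.
rewrite add0r => fin /sums_to_uniq/(_ (fin _)) fy.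
rewrite /coef fy => [|i ni]; last first.
  by rewrite !linearZ /= f_e ltn_eqF ?mulr0.
by rewrite !linearZ /= f_e eqxx mulr1 fmorphV mulrC mulfK.
Qed.

Lemma incl_power_sum (c : nat -> C) y (g : C^o -> C^o) :
  sums_to (fun n => c n *: monomial n) y ->
  (forall z, nrm z < 1 -> power_sum c z (g z)) -> incl y = restrict_disk g.
Proof.
move=> cy cg; apply/funext => z; rewrite /incl /restrict_disk.
by apply: (series_funE (coef_sums_to cy)) => //; exact: cg.
Qed.

(** The Taylor coefficients decay geometrically and alpha grows
    subexponentially, so the corresponding series converges in Y. *)
Lemma hol_space_holomorphic (U : set C^o) (g : C^o -> C^o) : open U ->
  closure (@unit_disk R) `<=` U -> holomorphic U g ->
  exists y, incl y = restrict_disk g.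
Proof.
move=> oU DU gU; have [rho rho1 rhoU] := larger_disk oU DU.
have [|c [K [t [t01 cK cg]]]] := @taylor_expansion R g rho rho1.
  by move=> w /rhoU; exact: gU.
have [K' [t' [K'0 t'01 H]]] := subexponential_geometric (fun n => ltW (alpha_gt0 n))
  (subexponential_root alpha_gt0 alpha_root) t01.
have K0 : 0 <= K.
  by have := cK 0%N; rewrite expr0 mulr1; apply: le_trans; exact: nrm_ge0.
have [|y cy] := @sums_to_exists R Y (fun n => c n *: monomial n) (K * K') t' t'01.
  move=> n; rewrite nrmZ nrm_monomial -mulrA.
  rewrite (le_trans (ler_wpM2r (ltW (alpha_gt0 n)) (cK n)))// -mulrA.
  by rewrite ler_wpM2l// mulrC.
by exists y; exact: incl_power_sum cy cg.
Qed.

Lemma hol_space_polynomial (p : {poly C}) :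
  incl (\sum_(i < size p) p`_i *: monomial i) = restrict_disk (fun z => p.[z]).
Proof.
apply: (@incl_power_sum (fun n => p`_n)) => [|z _].
  by apply: (sums_to_finite (a := fun n => p`_n *: monomial n)) => i pi;
    rewrite nth_default ?scale0r.
rewrite horner_coef; apply: (sums_to_finite (a := fun n => p`_n * z ^+ n)) => i pi.
by rewrite nth_default ?mul0r.
Qed.

Lemma hol_space_monomial n : incl (monomial n) = restrict_disk (fun z => z ^+ n).
Proof.
have := hol_space_polynomial 'X^n; rewrite size_polyXn big_ord_recr /=.
rewrite big1 ?add0r => [|i _]; last by rewrite coefXn ltn_eqF ?scale0r.
rewrite coefXn eqxx scale1r => ->; congr restrict_disk.
by apply/funext => z; rewrite hornerXn.
Qed.

Lemma incl_span_polynomial N y : y = biproj N e f y ->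
  exists p : {poly C}, incl y = restrict_disk (fun z => p.[z]).
Proof.
move=> yP; exists (\poly_(i < N) coef y i).
rewrite -hol_space_polynomial; congr incl.
set p := \poly_(i < N) _.
have -> : \sum_(i < size p) p`_i *: monomial i = \sum_(i < N) p`_i *: monomial i.
  have pN : (size p <= N)%N by exact: size_poly.
  rewrite -[in RHS](subnKC pN) big_split_ord /= [X in _ + X]big1 ?addr0//.
  by move=> i _; rewrite nth_default ?scale0r// leq_addr.
rewrite [LHS]yP; apply: eq_bigr => i _.
rewrite coef_poly ltn_ord /coef /monomial scalerA mulrAC fmorphV mulVf ?mul1r//.
exact: alphaC_neq0.
Qed.

End Construction.

Theorem theorem1p3 (R : realType) (Y : completeNormedModType R[i])
    (alpha : nat -> R)
    (Ysep : separable_space Y) (Yinf : ~ finite_dimensional Y)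
    (alpha_gt0 : forall n, 0 < alpha n)
    (alpha_root : (alpha n `^ (n%:R^-1)) @[n --> \oo] --> (1 : R)) :
  exists X : banach_hol_space R,
    [/\ isometrically_isomorphic X Y,
        forall (U : set R[i]^o) (g : R[i]^o -> R[i]^o),
          open U -> closure (@unit_disk R) `<=` U -> holomorphic U g ->
          exists x : X, bhs_incl X x = restrict_disk g,
        (forall p : {poly R[i]},
           exists x : X, bhs_incl X x = restrict_disk (fun z => p.[z])) /\
        dense [set x : X | exists p : {poly R[i]},
                 bhs_incl X x = restrict_disk (fun z => p.[z])]
      & forall n, exists2 x : X,
          bhs_incl X x = restrict_disk (fun z => z ^+ n)
          & `|x| = (alpha n)%:C%C].
Proof.
have [xs xs_dense] := separable_sequence Ysep.
have /choice[gs gsP] := fun k => norming_functional (xs k).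
have [e [f [e1 fe fb span total]]] :=
  markushevich_basis Yinf xs (fun k y => (gsP k).2 y).
have f_total y : (forall n, f n y = 0) -> y = 0.
  move=> fy; apply/eqP; apply: contraT; rewrite -nrm_gt0 => y0.
  have y20 : 0 < nrm y / 2 by lra.
  have [k hk] := xs_dense y _ y20.
  have gky := total k y fy.
  have [gk1 gk2] := gsP k.
  have := gk2 (y - xs k); rewrite linearB gky sub0r nrmN gk1.
  rewrite nrm_real ger0_norm ?nrm_ge0// => h1.
  have := ler_sub_nrm y (y - xs k); rewrite subKr => h2.
  by exfalso; lra.
pose X := hol_space alpha_gt0 alpha_root fb f_total.
exists X; split.
- exists idfun; split => //; exact: bij_id.
- by move=> U g; exact: hol_space_holomorphic.
- split=> [p|O [y0 Oy0] oO].
    by exists (\sum_(i < size p) p`_i *: monomial alpha e i); exact: hol_space_polynomial.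
  have : nbhs y0 O by apply: open_nbhs_nbhs.
  move=> /nbhs_ballP[_ /= /complex_pos[d d0 ->] dO].
  have [k hk] := xs_dense y0 d d0; exists (xs k); split.
    by apply: dO; rewrite -ball_normE /= nrmE ltcR.
  by have [N hN] := span k; apply: incl_span_polynomial hN.
- move=> n; exists (monomial alpha e n); first exact: hol_space_monomial.
  by rewrite nrmE nrm_monomial.
Qed.
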